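(* Let $t_1=0.296151$ and $t_2=0.805018$. Then the weak competitive ratio of the Double-threshold Transaction algorithm $\mathrm{ALG}$ (described in the context, with thresholds $t_1,t_2$) for SPVT with seller's price $0$ is at most $1.83683$, this constant being rounded to five decimals; that is, for every $n\ge 1$ and every $X_1>\dots>X_n\ge0$ with $X_1>0$, $$\frac{\mathrm{OPT}(\boldsymbol X)}{\mathrm{ALG}(\boldsymbol X)}\le 1.836835 .$$
   Context: SPVT with zero-price seller ($\mathrm{SPVT}_0$): there are $n$ buyers with prices $X_1>\dots>X_n\ge 0$ and one seller with price $0$. The seller initially holds one item; the intermediary and the buyers hold none. The $n+1$ agents arrive one by one in a uniformly random order; on arrival an agent reveals its price and whether it is a buyer or the seller. On each arrival the intermediary must immediately and irrevocably decide whether to trade: it may buy the item from the seller when the seller arrives, and it may sell the item to an arriving buyer only if it currently holds it. The social welfare is the price of the agent finally holding the item ($0$ if it is the seller or the intermediary). $\mathrm{ALG}(\boldsymbol X)$ is the expected social welfare of the algorithm. Weak offline optimum: for each arrival order, the offline algorithm knows the order and all prices in advance and makes the best feasible decisions for that order (it obtains the highest price among the buyers arriving after the seller, or $0$ if there are none); $\mathrm{OPT}(\boldsymbol X)=\sum_{i=1}^n\frac{X_i}{i(i+1)}$ is the expectation of this optimum over the uniformly random order. The weak competitive ratio is the worst case of $\mathrm{OPT}(\boldsymbol X)/\mathrm{ALG}(\boldsymbol X)$. Double-threshold Transaction algorithm with thresholds $t_1\le t_2$. Draw $n+1$ independent uniform random numbers on $[0,1]$, sort them, and regard the $i$-th smallest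 as the arrival time of the $i$-th arriving agent (so arrival times of the agents are i.i.d. uniform on $[0,1]$). When the seller arrives, buy the item. After that, sell the item to the earliest buyer $b$ (arriving after the purchase) satisfying one of: (1) $b$ arrives after time $t_1$ and $b$ has the highest price among all buyers arrived so far (including those before the seller, and $b$ itself); (2) $b$ arrives after time $t_2$ and $b$ has the second-highest price among all buyers arrived so far. If no such buyer exists, no sale is made. *)

(* Defs.v *)
From mathcomp Require Import all_boot all_order all_algebra all_fingroup.
From mathcomp Require Import all_classical all_reals all_analysis.

Set Implicit Arguments.
Unset Strict Implicit.
Unset Printing Implicit Defensive.

Import Order.TTheory GRing.Theory Num.Theory.

Local Open Scope ring_scope.

(* The n+1 agents are the elements of 'I_n.+1: agent 0 is the seller, whose
   price is 0, and agent i+1 is the buyer with the price X i, for i : 'I_n.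
   An arrival order is a permutation s : 'S_n.+1, where s a is the position
   (from 0 to n) at which the agent a arrives. *)
Definition seller {n : nat} : 'I_n.+1 := ord0.

Definition buyer {n : nat} (i : 'I_n) : 'I_n.+1 := lift ord0 i.

Definition after_seller (n : nat) (s : 'S_n.+1) (i : 'I_n) : bool :=
  (s seller < s (buyer i))%N.

(* Since all prices are nonnegative, the default value 0 of the maximum is
   reached only when no sale improves on it. *)
Definition offline_welfare (R : realType) (n : nat) (X : 'I_n -> R)
    (s : 'S_n.+1) : R :=
  \big[Num.max/0]_(i < n | after_seller s i) X i.

Definition OPT (R : realType) (n : nat) (X : 'I_n -> R) : R :=
  (\sum_(s : 'S_n.+1) offline_welfare X s) / (n.+1)`!%:R.

(* The agent at position k receives the k-th smallest (counted from 0) of the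
   n+1 numbers u. *)
Definition arrival_time (R : realType) (n : nat) (u : 'I_n.+1 -> R)
    (s : 'S_n.+1) (a : 'I_n.+1) : R :=
  nth 0 (sort <=%R [seq u k | k <- enum 'I_n.+1]) (s a).

(* The number of buyers that arrived before i with a price higher than that of
   i: it is 0 (resp. 1) when i has the highest (resp. second-highest) price
   among the buyers arrived so far. *)
Definition num_better (R : realType) (n : nat) (X : 'I_n -> R)
    (s : 'S_n.+1) (i : 'I_n) : nat :=
  #|[pred j : 'I_n | (s (buyer j) < s (buyer i))%N && (X i < X j)]|.

Definition acceptable (R : realType) (t1 t2 : R) (n : nat) (X : 'I_n -> R)
    (u : 'I_n.+1 -> R) (s : 'S_n.+1) (i : 'I_n) : bool :=
  after_seller s i &&
  ((t1 < arrival_time u s (buyer i)) && (num_better X s i == 0)%N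
   || (t2 < arrival_time u s (buyer i)) && (num_better X s i == 1)%N).

Definition sold_to (R : realType) (t1 t2 : R) (n : nat) (X : 'I_n -> R)
    (u : 'I_n.+1 -> R) (s : 'S_n.+1) (i : 'I_n) : bool :=
  acceptable t1 t2 X u s i &&
  [forall j : 'I_n, acceptable t1 t2 X u s j ==>
                      (s (buyer i) <= s (buyer j))%N].

Definition welfare (R : realType) (t1 t2 : R) (n : nat) (X : 'I_n -> R)
    (u : 'I_n.+1 -> R) (s : 'S_n.+1) : R :=
  if [pick i | sold_to t1 t2 X u s i] is Some i then X i else 0.

(* The numbers drawn by the algorithm are given as random variables U; the
   arrival order is uniform and independent of them, hence the average over s
   of the expectation for a fixed order. *)
Definition ALG (R : realType) (t1 t2 : R) (n : nat) (X : 'I_n -> R)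
    (d : measure_display) (T : measurableType d) (P : probability T R)
    (U : 'I_n.+1 -> {RV P >-> R}) : R :=
  (\sum_(s : 'S_n.+1)
     fine ('E_P[(fun w : T => welfare t1 t2 X (fun k => U k w) s)]))
  / (n.+1)`!%:R.

Local Open Scope classical_set_scope.

Definition mutually_independent (R : realType) (d : measure_display)
    (T : measurableType d) (P : probability T R) (I : finType)
    (U : I -> {RV P >-> R}) : Prop :=
  forall (J : {set I}) (B : I -> set R), (forall k, measurable (B k)) ->
    P (\bigcap_(k in [set` J]) (U k @^-1` B k))
    = \big[*%E/1%E]_(k in J) P (U k @^-1` B k).

Definition uniform01 (R : realType) (d : measure_display)
    (T : measurableType d) (P : probability T R) (V : {RV P >-> R}) : Prop :=
  forall B : set R, measurable B ->
    distribution P V B = uniform_prob (@ltr01 R) B.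

(* Main.v *)
(* By Abel summation over the differences X_k - X_(k+1) it suffices to bound from
   below, for each k, the probability g_k that the item goes to one of the k best
   buyers. The seller is the last one among himself and the k best buyers with
   probability 1/(k+1), so that OPT has the coefficients k/(k+1), and
   g_k >= k/((k+1)c) is needed.

   Let s and x be the arrival times of the seller and of buyer i. No sale happens
   before x as soon as the best of the other buyers arrived before x did so before
   max(t1,s) and, if x > t2, the second best one before max(t2,s). Revealing the
   buyers from the best one on, this has probability at least max(t1,s)/x, resp.
   max(t1,s)max(t2,s)/x^2, whatever the number of buyers. Integrating over s and x
   and summing over i <= k gives an explicit lower bound for g_k, which is almost
   attained for k = 1 and in the limit of infinite k; the other values of k follow
   by interpolating between k = 2 and infinite k.

   The algorithm only compares the arrival times with t1 and t2, which are
   rational, so these times can be rounded to a grid of N cells having t1 and t2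
   among its end points. The integrals become Riemann sums, and N goes to infinity
   at the end. *)

Require Import Defs.
From mathcomp Require Import all_boot all_order all_algebra all_fingroup.
From mathcomp Require Import all_classical all_reals all_analysis.
From mathcomp Require Import measurable_realfun.
From mathcomp Require Import ring lra zify.
Import Order.TTheory GRing.Theory Num.Theory.

Local Open Scope ring_scope.

(** * Independent uniform cells *)

Section Avg.
Variable R : realFieldType.
Variable N : nat.

(* The expectation of [f] at [m] independent uniform cells, as an iterated
   average: the buyers can then be revealed one by one, the best one first. *)
Fixpoint avg (m : nat) (f : seq nat -> R) : R :=
  if m is m'.+1 then (\sum_(c < N) avg m' (fun L => f (nat_of_ord c :: L))) / N%:R
  else f [::].

Lemma eq_avg m f g : (forall L, size L = m -> f L = g L) -> avg m f = avg m g.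
Proof.
elim: m f g => [|m IH] f g fg /=; first exact: fg.
by congr (_ / _); apply: eq_bigr => c _; apply: IH => L sL; rewrite fg //= sL.
Qed.

Lemma avgZ m a f : avg m (fun L => a * f L) = a * avg m f.
Proof.
elim: m f => [|m IH] f //=; rewrite mulrA mulr_sumr; congr (_ / _).
by apply: eq_bigr => c _; rewrite IH.
Qed.

Lemma avgD m f g : avg m (fun L => f L + g L) = avg m f + avg m g.
Proof.
elim: m f g => [|m IH] f g //=; rewrite -mulrDl -big_split /=; congr (_ / _).
by apply: eq_bigr => c _; rewrite IH.
Qed.

Lemma avg_sum (I : Type) (r : seq I) (Q : pred I) m (f : I -> seq nat -> R) :
  avg m (fun L => \sum_(i <- r | Q i) f i L) = \sum_(i <- r | Q i) avg m (f i).
Proof.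
elim: m f => [|m IH] f //=.
under eq_bigr => c _ do rewrite IH.
by rewrite exchange_big /= mulr_suml.
Qed.

Lemma avg_cat m1 m2 f :
  avg (m1 + m2) f = avg m1 (fun L1 => avg m2 (fun L2 => f (L1 ++ L2))).
Proof.
elim: m1 f => [|m1 IH] f //=; congr (_ / _); apply: eq_bigr => c _.
by rewrite IH.
Qed.

Lemma avg_cst m a : (0 < N)%N -> avg m (fun=> a) = a.
Proof.
move=> N0; elim: m => [|m IH] //=; rewrite sumr_const card_ord IH -[a *+ N]mulr_natr.
by rewrite mulfK // pnatr_eq0 -lt0n.
Qed.

(** Identifies the iterated average with the expectation under the uniform law on all assignments of
    cells; the induction splits off the coordinate [ord0]. *)
Lemma avg_ffun m f :
  (\sum_(v : {ffun 'I_m -> 'I_N}) f [seq nat_of_ord (v j) | j <- enum 'I_m]) / N%:R ^+ m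
  = avg m f.
Proof.
elim: m f => [|m IH] f /=.
  rewrite expr0 divr1.
  pose v0 : {ffun 'I_0 -> 'I_N} := ffun0 (card_ord 0).
  have all_v0 v : v = v0 by apply/ffunP => -[].
  rewrite (bigD1 v0) //= big1 ?addr0; first by rewrite enum_ord0.
  by move=> v; rewrite (all_v0 v) eqxx.
pose glue (x : 'I_N * {ffun 'I_m -> 'I_N}) : {ffun 'I_m.+1 -> 'I_N} :=
  [ffun i => if unlift ord0 i is Some j then x.2 j else x.1].
pose split (v : {ffun 'I_m.+1 -> 'I_N}) : 'I_N * {ffun 'I_m -> 'I_N} :=
  (v ord0, [ffun j => v (lift ord0 j)]).
rewrite (reindex glue); last first.
  exists split => [[c v] _|v _].
    rewrite /split /glue /= ffunE unlift_none; congr pair.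
    by apply/ffunP => j; rewrite !ffunE liftK.
  apply/ffunP => i; rewrite ffunE; case: unliftP => [j|] -> //=.
  by rewrite ffunE.
rewrite -(pair_bigA _ (fun c v => f [seq nat_of_ord (glue (c, v) j) | j <- enum 'I_m.+1])) /=.
rewrite exprSr invfM mulrA mulr_suml; congr (_ / _).
apply: eq_bigr => c _; rewrite -IH; congr (_ / _); apply: eq_bigr => v _.
rewrite enum_ordSl /= ffunE unlift_none /= -map_comp; congr (f (_ :: _)).
by apply: eq_map => j /=; rewrite ffunE liftK.
Qed.

End Avg.

(* [L] lists the arrival cells of the buyers by decreasing price, and [cs] the
   bounds max(t1, s), max(t2, s), where s is the arrival of the seller: among
   the buyers arrived by cell [q], the best one must arrive before the first
   bound, the second best one before the second bound. This rules out every
   sale before [q]. *)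
Fixpoint no_sale (q : nat) (cs L : seq nat) : bool :=
  if cs is c :: cs' then
    if L is l :: L' then
      if (q < l)%N then no_sale q cs L' else (l < c)%N && no_sale q cs' L'
    else true
  else true.

Lemma no_sale_nil q L : no_sale q [::] L. Proof. by case: L. Qed.

(** * Recursions for the probability that no sale precedes a given cell *)

Section NoSaleProb.
Variable R : realFieldType.
Variables N q : nat.
Hypothesis qN : (q < N)%N.

Let x : R := q.+1%:R / N%:R.
Let y : R := 1 - x.

Let N_gt0 : 0 < N%:R :> R.
Proof. by rewrite ltr0n (leq_ltn_trans _ qN). Qed.

Let x_gt0 : 0 < x. Proof. by rewrite divr_gt0 // ltr0n. Qed.

Let y_ge0 : 0 <= y.
Proof. by rewrite subr_ge0 ler_pdivrMr // mul1r ler_nat. Qed.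

Lemma sum_ltn c : (c <= N)%N -> \sum_(l < N) (l < c)%:R = c%:R :> R.
Proof.
move=> cN; under eq_bigr => l _ do rewrite mulrb.
rewrite -big_mkcond /= -(big_ord_widen N (fun=> 1) cN).
by rewrite sumr_const card_ord.
Qed.

(** One more buyer is revealed: after cell [q] (probability [y]) nothing changes, before [c] a bound
    is used up, and in between the event fails. *)
Lemma avg_step c (A B : R) (g : nat -> R) : (c <= N)%N ->
  (forall l, g l = (q < l)%:R * A + (l < c)%:R * B) ->
  (\sum_(l < N) g l) / N%:R = y * A + c%:R / N%:R * B.
Proof.
move=> cN gE; under eq_bigr => l _ do rewrite gE.
rewrite big_split /= -!mulr_suml sum_ltn //.
have -> : \sum_(l < N) (q < l)%:R = N%:R - q.+1%:R :> R.
  rewrite -[q.+1%:R](sum_ltn _ qN).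
  rewrite -[N in N%:R](card_ord N) -sumr_const -sumrB.
  by apply: eq_bigr => l _; rewrite ltnS ltnNge; case: (l <= q)%N => /=; ring.
rewrite /y /x; field; exact: lt0r_neq0.
Qed.

Definition prob_no_sale cs M : R := avg R N M (fun L => (no_sale q cs L)%:R).

Lemma prob_no_sale_nil M : prob_no_sale [::] M = 1.
Proof.
rewrite /prob_no_sale (eq_avg _ _ _ _ (fun=> 1)) => [|L _]; last by rewrite no_sale_nil.
by rewrite avg_cst // (leq_ltn_trans _ qN).
Qed.

Lemma prob_no_sale_consS c cs M : (c <= q.+1)%N ->
  prob_no_sale (c :: cs) M.+1 = y * prob_no_sale (c :: cs) M + c%:R / N%:R * prob_no_sale cs M.
Proof.
move=> cq; apply: (avg_step c _ _
  (fun l => avg R N M (fun L => (no_sale q (c :: cs) (l :: L))%:R))).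
  exact: leq_trans qN.
move=> l; rewrite /prob_no_sale /= -!avgZ -avgD; apply: eq_avg => L _.
case: (ltnP q l) => ql; last by case: (l < c)%N => /=; rewrite ?mul0r ?add0r ?mul1r.
have /negbTE -> : ~~ (l < c)%N by rewrite -leqNgt (leq_trans cq).
by rewrite mul1r mul0r addr0.
Qed.

(** The left side is the fixed point of the recursion z = y z + c/N and is at most 1, the
    probability for [M = 0]. Hence the bound does not depend on the number of buyers. *)
Lemma prob_no_sale1_ge c M : (c <= q.+1)%N -> c%:R / N%:R / x <= prob_no_sale [:: c] M.
Proof.
move=> cq; have cx : c%:R / N%:R / x <= 1.
  by rewrite ler_pdivrMr // mul1r ler_pM2r ?invr_gt0 // ler_nat.
elim: M => [|M IH]; first exact: cx.
rewrite prob_no_sale_consS // prob_no_sale_nil mulr1.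
apply: le_trans (_ : y * (c%:R / N%:R / x) + c%:R / N%:R <= _).
  by rewrite le_eqVlt /y; apply/orP; left; apply/eqP; field; rewrite !lt0r_neq0.
by rewrite lerD2r ler_wpM2l.
Qed.

(** Again a fixed point, now with the one-bound estimate as inhomogeneous term. *)
Lemma prob_no_sale2_ge c1 c2 M : (c1 <= q.+1)%N -> (c2 <= q.+1)%N ->
  c1%:R / N%:R * (c2%:R / N%:R) / x ^+ 2 <= prob_no_sale [:: c1; c2] M.
Proof.
move=> cq1 cq2; elim: M => [|M IH].
  have cx c : (c <= q.+1)%N -> 0 <= c%:R / N%:R / x <= 1.
    move=> cq; apply/andP; split; first by rewrite !divr_ge0 ?ler0n ?ltW.
    by rewrite ler_pdivrMr // mul1r ler_pM2r ?invr_gt0 // ler_nat.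
  have /andP[c10 c11] := cx _ cq1; have /andP[c20 c21] := cx _ cq2.
  rewrite expr2 invfM mulrACA; exact: mulr_ile1.
rewrite prob_no_sale_consS //.
apply: le_trans (_ : y * (c1%:R / N%:R * (c2%:R / N%:R) / x ^+ 2)
   + c1%:R / N%:R * (c2%:R / N%:R / x) <= _).
  by rewrite le_eqVlt /y; apply/orP; left; apply/eqP; field; rewrite !lt0r_neq0.
apply: lerD; first by rewrite ler_wpM2l.
by rewrite ler_wpM2l ?divr_ge0 ?ler0n // prob_no_sale1_ge.
Qed.

(* [L1] and [L2] are the cells of the buyers of higher and of lower price. *)
Definition prob_wins cs k M : R := avg R N k (fun L1 => avg R N M (fun L2 =>
  ((count (fun l => l <= q)%N L1 < size cs)%N && no_sale q cs (L1 ++ L2))%:R)).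

Lemma prob_wins0 c cs M : prob_wins (c :: cs) 0 M = prob_no_sale (c :: cs) M.
Proof. by []. Qed.

Lemma prob_wins_nil k M : prob_wins [::] k M = 0.
Proof.
rewrite /prob_wins (eq_avg _ _ _ _ (fun=> 0)) => [|L1 _].
  by rewrite avg_cst // (leq_ltn_trans _ qN).
by rewrite avg_cst // (leq_ltn_trans _ qN).
Qed.

Lemma prob_winsS c cs k M : (c <= q.+1)%N ->
  prob_wins (c :: cs) k.+1 M = y * prob_wins (c :: cs) k M + c%:R / N%:R * prob_wins cs k M.
Proof.
move=> cq; apply: (avg_step c _ _ (fun l => avg R N k (fun L1 => avg R N M
  (fun L2 => ((count (fun l => l <= q)%N (l :: L1) < size (c :: cs))%N &&
              no_sale q (c :: cs) ((l :: L1) ++ L2))%:R)))).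
  exact: leq_trans qN.
move=> l; rewrite /prob_wins /= -!avgZ -avgD; apply: eq_avg => L1 _.
rewrite -!avgZ -avgD; apply: eq_avg => L2 _.
case: (ltnP q l) => ql.
  have /negbTE -> : ~~ (l < c)%N by rewrite -leqNgt (leq_trans cq).
  by rewrite add0n mul1r mul0r addr0.
rewrite add1n ltnS mul0r add0r.
by case: (l < c)%N => /=; rewrite ?andbF ?mul0r ?mul1r.
Qed.

Lemma prob_wins1_ge c k M : (c <= q.+1)%N ->
  y ^+ k * (c%:R / N%:R / x) <= prob_wins [:: c] k M.
Proof.
move=> cq; elim: k => [|k IH]; first by rewrite expr0 mul1r prob_wins0 prob_no_sale1_ge.
by rewrite prob_winsS // prob_wins_nil mulr0 addr0 exprS -mulrA ler_wpM2l.
Qed.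

(** The first summand is the case that none of the [k] better buyers has arrived by cell [q]. The
    second one is the case that exactly one has: he uses up [c1], and only [c2] is left for the
    buyers of lower price. *)
Lemma prob_wins2_ge c1 c2 k M : (c1 <= q.+1)%N -> (c2 <= q.+1)%N ->
  (y ^+ k / x ^+ 2 + k%:R * y ^+ k.-1 / x) * (c1%:R / N%:R * (c2%:R / N%:R))
  <= prob_wins [:: c1; c2] k M.
Proof.
move=> cq1 cq2; elim: k => [|k IH].
  by rewrite !mul0r addr0 expr0 div1r mulrC prob_wins0 prob_no_sale2_ge.
rewrite prob_winsS //.
apply: le_trans (_ : y * ((y ^+ k / x ^+ 2 + k%:R * y ^+ k.-1 / x) *
   (c1%:R / N%:R * (c2%:R / N%:R)))
   + c1%:R / N%:R * (y ^+ k * (c2%:R / N%:R / x)) <= _); last first.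
  apply: lerD; first by rewrite ler_wpM2l.
  by rewrite ler_wpM2l ?divr_ge0 ?ler0n // prob_wins1_ge.
(* At [k = 0] the exponent [k.-1] is truncated, but the factor [k%:R] makes both sides vanish. *)
have kE : y * (k%:R * y ^+ k.-1) = k%:R * y ^+ k.
  by case: k {IH} => [|k]; rewrite ?mul0r ?mulr0 // exprS mulrCA.
rewrite le_eqVlt; apply/orP; left; apply/eqP => /=.
rewrite -natr1 exprS.
transitivity ((y * y ^+ k / x ^+ 2 + (y * (k%:R * y ^+ k.-1)) / x + y ^+ k / x)
   * (c1%:R / N%:R * (c2%:R / N%:R))); last by field; rewrite !lt0r_neq0.
by rewrite kE; field; rewrite !lt0r_neq0.
Qed.

End NoSaleProb.

(** * Soundness of the winning condition *)

(** The length is the number of ranks acceptable in cell [q]: one before t2, two after it. *)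
Definition bounds (T1 T2 p q : nat) : seq nat :=
  if (q < T2)%N then [:: maxn T1 p] else [:: maxn T1 p; maxn T2 p].

(* [z] lists the arrival cells of the seller and of the buyers by decreasing
   price. The bound on [count] says that buyer [i] is the best one so far, or
   the second best one if he arrives after t2. The order of two
   agents is only used when their cells differ, so that ties do not matter. *)
Definition wins (T1 T2 : nat) (z : seq nat) (i : nat) : bool :=
  let p := head 0%N z in let L := behead z in
  let q := nth 0%N L i in let cs := bounds T1 T2 p q in
  [&& (p < q)%N, (T1 <= q)%N,
      (count (fun l => l <= q)%N (take i L) < size cs)%N
    & no_sale q cs (take i L ++ drop i.+1 L)].

(** The first entry of [L] that is at most [q] lies below [c], so it is not entry [j] and must
    precede it. Hence [j] is not the best buyer so far. *)
Lemma no_sale_earlier1 q c cs L j : no_sale q (c :: cs) L -> (j < size L)%N ->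
  (nth 0%N L j <= q)%N -> (c <= nth 0%N L j)%N ->
  exists2 w, (w < j)%N & (nth 0%N L w < c)%N.
Proof.
elim: L j => [|l L IH] //= j; case: (ltnP q l) => [ql noL|lq /andP[lc _]].
  case: j => [|j] /=; first by move=> _; rewrite leqNgt ql.
  rewrite ltnS => jL jq cj; have [w wj wc] := IH _ noL jL jq cj.
  by exists w.+1.
case: j => [|j] /=; first by move=> _ _; rewrite leqNgt lc.
by move=> _ _ _; exists 0%N.
Qed.

(** Likewise the first two entries that are at most [q] lie below [c2], so that [j] ranks third at
    best. *)
Lemma no_sale_earlier2 q c1 c2 L j : (c1 <= c2)%N -> no_sale q [:: c1; c2] L ->
  (j < size L)%N -> (nth 0%N L j <= q)%N -> (c2 <= nth 0%N L j)%N ->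
  exists w1 w2, [/\ (w1 < w2)%N, (w2 < j)%N,
    (nth 0%N L w1 < c2)%N & (nth 0%N L w2 < c2)%N].
Proof.
move=> c12; elim: L j => [|l L IH] // j.
rewrite [no_sale _ _ _]/=; case: (ltnP q l) => [ql noL|lq /andP[lc noL]].
  case: j => [|j] /=; first by move=> _; rewrite leqNgt ql.
  rewrite ltnS => jL jq cj; have [w1 [w2 [w12 w2j wc1 wc2]]] := IH _ noL jL jq cj.
  by exists w1.+1, w2.+1.
case: j => [|j] /=; first by move=> _ _; rewrite leqNgt (leq_trans lc).
rewrite ltnS => jL jq cj; have [w wj wc] := no_sale_earlier1 _ _ _ _ _ noL jL jq cj.
by exists 0%N, w.+1; split => //=; exact: leq_trans c12.
Qed.

(** There are more bounds than entries of [L1] arrived by [q], so each such entry is tested against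
    a bound and lies strictly below [q]. This excludes ties of buyer [i] with the better ones. *)
Lemma no_sale_neq q cs L1 L2 : all (fun c => c <= q)%N cs ->
  (count (fun l => l <= q)%N L1 < size cs)%N -> no_sale q cs (L1 ++ L2) -> q \notin L1.
Proof.
elim: L1 cs => [|l L1 IH] [|c cs] //= /andP[cq csq].
case: (ltnP q l) => ql.
  rewrite add0n => cnt noL; rewrite inE negb_or (ltn_eqF ql) /=.
  by apply: (IH (c :: cs)) => //=; rewrite cq.
rewrite add1n ltnS => cnt /andP[lc noL].
by rewrite inE negb_or gtn_eqF ?(leq_trans lc) //= (IH cs).
Qed.

Lemma nth_take_drop (T : Type) (x0 : T) (L : seq T) i a : (i < size L)%N ->
  nth x0 (take i L ++ drop i.+1 L) a = nth x0 L (bump i a).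
Proof.
move=> iL; rewrite nth_cat size_takel ?(ltnW iL) // /bump.
case: ltnP => ai; first by rewrite nth_take.
by rewrite nth_drop; congr (nth _ _ _); lia.
Qed.

Lemma count_take_enum (T : Type) (n i : nat) (f : 'I_n -> T) (a : pred T) :
  count a (take i [seq f j | j <- enum 'I_n])
  = #|[pred j : 'I_n | (j < i)%N && a (f j)]|.
Proof.
have -> : take i [seq f j | j <- enum 'I_n]
    = [seq f j | j <- [seq j : 'I_n <- enum 'I_n | (j < i)%N]].
  rewrite -map_take; congr (map f _); apply: (inj_map val_inj).
  rewrite -[RHS](filter_map (@nat_of_ord n) (fun k => k < i)%N) map_take val_enum_ord.
  case: (leqP i n) => ni; first by rewrite (filter_iota_ltn 0) // take_iota (minn_idPl ni).
  rewrite take_oversize ?size_iota ?(ltnW ni) //; apply/esym/all_filterP/allP.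
  by move=> k; rewrite mem_iota => /andP[_ kn]; apply: ltn_trans ni.
rewrite count_map count_filter cardE enumT size_filter.
by apply: eq_count => j /=; rewrite andbC.
Qed.

Section Soundness.
Variables (R : realType) (n : nat) (X : 'I_n -> R).
Hypothesis X_decreasing : forall i j : 'I_n, (i < j)%N -> X j < X i.

Lemma X_lt (i j : 'I_n) : (X i < X j) = (j < i)%N.
Proof.
case: (ltngtP j i) => [ji|ij|/val_inj ->]; last by rewrite ltxx.
  by rewrite X_decreasing.
by rewrite lt_gtF // X_decreasing.
Qed.

Variables (t1 t2 : R) (T1 T2 : nat).
Hypothesis T12 : (T1 <= T2)%N.
Variables (u : 'I_n.+1 -> R) (s : 'S_n.+1) (z : 'I_n.+1 -> nat).
Hypothesis z_mono : forall a b, (z a < z b)%N -> (s a < s b)%N.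
Hypothesis time1 : forall a, (t1 < arrival_time u s a) = (T1 <= z a)%N.
Hypothesis time2 : forall a, (t2 < arrival_time u s a) = (T2 <= z a)%N.

(** Buyer [i] is acceptable because the count in [wins] is his [num_better]. An acceptable buyer [j]
    before him would have too many better buyers ahead of him, by the two lemmas on [no_sale]. *)
Lemma wins_sold (i : 'I_n) :
  wins T1 T2 [seq z a | a <- enum 'I_n.+1] i -> sold_to t1 t2 X u s i.
Proof.
rewrite enum_ordSl /= -map_comp /wins /=.
set L := map _ _; set p := z ord0; set q := nth _ _ _.
have sL : size L = n by rewrite size_map size_enum_ord.
have nthL (j : 'I_n) : nth 0%N L j = z (buyer j).
  by rewrite (nth_map j) ?size_enum_ord // nth_ord_enum.
have qE : q = z (buyer i) by rewrite /q nthL.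
case/and4P => pq T1q cnt noL.
have bq : all (fun c => c <= q)%N (bounds T1 T2 p q).
  by rewrite /bounds; case: (ltnP q T2) => qT /=; rewrite !geq_max T1q (ltnW pq) ?qT.
have qL := no_sale_neq _ _ _ _ bq cnt noL.
have nbE : num_better X s i = count (fun l => l <= q)%N (take i L).
  rewrite count_take_enum; apply: eq_card => j; rewrite !inE X_lt andbC /=.
  apply: andb_id2l => ji; rewrite qE.
  have : z (buyer j) != q.
    apply: contra qL => /eqP <-; rewrite -nthL -(nth_take 0%N ji).
    by rewrite mem_nth // size_takel ?sL // ltnW.
  rewrite qE; case: (ltngtP (z (buyer j)) (z (buyer i))) => // [|/z_mono] ji' _.
    exact: z_mono.
  by apply/negbTE; rewrite -leqNgt ltnW.
have acc_i : acceptable t1 t2 X u s i.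
  rewrite /acceptable /after_seller z_mono -?qE //= time1 time2 -qE T1q nbE /=.
  move: cnt; rewrite /bounds; case: (ltnP q T2) => qT /=; first by case: count.
  by case: count => [|[]].
rewrite /sold_to acc_i; apply/forallP => j; apply/implyP => acc_j.
rewrite leqNgt; apply/negP => sji.
have ji : j != i by apply: contraTneq sji => ->; rewrite ltnn.
have zq : (z (buyer j) <= q)%N.
  by rewrite leqNgt qE; apply/negP => /z_mono; rewrite ltnNge ltnW.
case/andP: acc_j => s0j; rewrite time1 time2 => accj.
have pz : (p <= z (buyer j))%N.
  by rewrite leqNgt; apply/negP => /z_mono; rewrite ltnNge ltnW.
have T1z : (T1 <= z (buyer j))%N.
  by case/orP: accj => /andP[] // T2z _; exact: leq_trans T2z.
have m1z : (maxn T1 p <= z (buyer j))%N by rewrite geq_max T1z pz.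
(* [unbump i j] is the position of [j] in the list without entry [i]; the positions before it belong
   to buyers of higher price. *)
have better w : (w < unbump i j)%N ->
    (nth 0%N (take i L ++ drop i.+1 L) w < z (buyer j))%N ->
    exists b : 'I_n, [/\ b = bump i w :> nat, (s (buyer b) < s (buyer j))%N & X j < X b].
  move=> wj; have ij : (bump i w < j)%N.
    have /= jE := unbumpK ji; rewrite -jE.
    by rewrite ltnNge leq_bump2 -ltnNge.
  have bn : (bump i w < n)%N := ltn_trans ij (ltn_ord j).
  rewrite nth_take_drop ?sL // (nthL (Ordinal bn)) => zb.
  by exists (Ordinal bn); split => //; [exact: z_mono | rewrite X_lt].
have jsize : (unbump i j < size (take i L ++ drop i.+1 L))%N.
  rewrite size_cat size_takel ?size_drop sL; last exact: ltnW.
  move: (ltn_ord i) (ltn_ord j) ji; rewrite /unbump -val_eqE /=; lia.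
have nthj : nth 0%N (take i L ++ drop i.+1 L) (unbump i j) = z (buyer j).
  by rewrite nth_take_drop ?sL // unbumpK // nthL.
have [w1 w1j zw1] : exists2 w, (w < unbump i j)%N
    & (nth 0%N (take i L ++ drop i.+1 L) w < maxn T1 p)%N.
  have [cs' csE] : exists cs', bounds T1 T2 p q = maxn T1 p :: cs'.
    by rewrite /bounds; case: ifP; eexists.
  by rewrite csE in noL; apply: no_sale_earlier1 noL _ _ _; rewrite ?nthj.
have [b1 [_ sb1 Xb1]] := better _ w1j (leq_trans zw1 m1z).
have nb1 : num_better X s j != 0%N.
  by rewrite -lt0n; apply/card_gt0P; exists b1; rewrite inE sb1.
(* Having a better buyer before him, [j] can only qualify as second best after t2. Then [q] is past
   [T2] too, so two bounds apply and yield a second better buyer. *)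
move: accj; rewrite (negbTE nb1) andbF /= => /andP[T2z nb_eq1].
move: noL; rewrite /bounds ltnNge (leq_trans T2z zq) /= => noL.
have [w1' [w2' [w12 w2j zw1' zw2']]] : exists w1 w2,
    [/\ (w1 < w2)%N, (w2 < unbump i j)%N,
     (nth 0%N (take i L ++ drop i.+1 L) w1 < maxn T2 p)%N
   & (nth 0%N (take i L ++ drop i.+1 L) w2 < maxn T2 p)%N].
  apply: no_sale_earlier2 noL _ _ _; rewrite ?nthj //.
    by rewrite geq_max leq_max T12 leq_maxr.
  by rewrite geq_max T2z pz.
have m2z : (maxn T2 p <= z (buyer j))%N by rewrite geq_max T2z pz.
have [b1' [b1E sb1' Xb1']] := better _ (ltn_trans w12 w2j) (leq_trans zw1' m2z).
have [b2' [b2E sb2' Xb2']] := better _ w2j (leq_trans zw2' m2z).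
move: nb_eq1; apply/negP; rewrite neq_ltn; apply/orP; right.
apply: leq_trans (_ : #|[set b1'; b2']| <= _)%N.
  rewrite cards2 -val_eqE /= b1E b2E ltn_eqF //.
  by rewrite ltnNge leq_bump2 -ltnNge.
apply: subset_leq_card; apply/fintype.subsetP => b.
by rewrite !inE => /orP[] /eqP ->; rewrite ?sb1' ?sb2'.
Qed.

End Soundness.

(** The right end point of the cell, so that the strict comparison with [T%:R / N%:R] becomes
    [T <= c]. *)
Definition grid (R : realType) (N : nat) (c : 'I_N) : R := c.+1%:R / N%:R.

(** * From sorted grid times in random order to independent cells *)

Section GridWelfare.
Variables (R : realType) (n : nat) (X : 'I_n -> R).
Hypothesis X_decreasing : forall i j : 'I_n, (i < j)%N -> X j < X i.
Hypothesis X_ge0 : forall i : 'I_n, 0 <= X i.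
Variables (N T1 T2 : nat).
Hypothesis N_gt0 : (0 < N)%N.
Hypothesis T12 : (T1 <= T2)%N.

Let t1 : R := T1%:R / N%:R.
Let t2 : R := T2%:R / N%:R.

Let NR_gt0 : 0 < N%:R :> R. Proof. by rewrite ltr0n. Qed.

Lemma ltr_grid T (c : 'I_N) : (T%:R / N%:R < grid R N c) = (T <= c)%N.
Proof. by rewrite /grid ltr_pM2r ?invr_gt0 // ltr_nat ltnS. Qed.

Lemma ler_grid (b c : 'I_N) : (grid R N b <= grid R N c) = (b <= c)%N.
Proof. by rewrite /grid ler_pM2r ?invr_gt0 // ler_nat. Qed.

Lemma grid_sort (v : 'I_n.+1 -> 'I_N) : exists tau : 'S_n.+1,
  (forall s a, arrival_time (fun k => grid R N (v k)) s a = grid R N (v (tau (s a))))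
  /\ (forall j k : 'I_n.+1, (j <= k)%N -> (v (tau j) <= v (tau k))%N).
Proof.
pose u k := grid R N (v k); pose t := [tuple u k | k < n.+1].
have /tuple_permP[tau tauE] : perm_eq (sort <=%R [seq u k | k <- enum 'I_n.+1]) t.
  by rewrite perm_sort.
have nthE (j : 'I_n.+1) :
    nth 0 (sort <=%R [seq u k | k <- enum 'I_n.+1]) j = u (tau j).
  by rewrite tauE /= (nth_map j) ?size_enum_ord // nth_ord_enum tnth_mktuple.
exists tau; split=> [s a|j k jk]; first by rewrite /arrival_time nthE.
rewrite -ler_grid -/(u (tau j)) -/(u (tau k)) -!nthE.
apply: (sorted_leq_nth le_trans le_refl) => //.
- exact: sort_le_sorted.
- by rewrite inE size_sort size_map size_enum_ord.
- by rewrite inE size_sort size_map size_enum_ord.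
Qed.

Lemma sold_to_inj (t1' t2' : R) (u : 'I_n.+1 -> R) (s : 'S_n.+1) i j :
  sold_to t1' t2' X u s i -> sold_to t1' t2' X u s j -> i = j.
Proof.
move=> /andP[acci /forallP leqi] /andP[accj /forallP leqj].
have := implyP (leqi j) accj; have := implyP (leqj i) acci => ji ij.
have /perm_inj/lift_inj -> // : s (buyer i) = s (buyer j).
by apply/val_inj/eqP; rewrite eqn_leq ij ji.
Qed.

(** The item is sold to at most one buyer, so at most one summand is nonzero. *)
Lemma welfare_ge (t1' t2' : R) (u : 'I_n.+1 -> R) (s : 'S_n.+1) (w : pred 'I_n) :
  (forall i, w i -> sold_to t1' t2' X u s i) ->
  \sum_i X i * (w i)%:R <= welfare t1' t2' X u s.
Proof.
move=> w_sold; rewrite /welfare; case: pickP => [i0 sold0|none].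
  rewrite (bigD1 i0) //= big1 => [|i ii0].
    by rewrite addr0 ler_piMr // lern1 leq_b1.
  case wi: (w i); last by rewrite mulr0.
  by rewrite (sold_to_inj _ _ _ _ _ _ (w_sold _ wi) sold0) eqxx in ii0.
rewrite big1 // => i _; case wi: (w i); last by rewrite mulr0.
by have := none i; rewrite w_sold.
Qed.

(** Composing a uniform order with the fixed sorting permutation [tau] gives a uniform order again.
    So sorting the numbers and handing them out by arrival amounts to handing out the unsorted ones
    by a random permutation. *)
Lemma sum_welfare_ge (v : 'I_n.+1 -> 'I_N) :
  \sum_(s : 'S_n.+1) \sum_i
    X i * (wins T1 T2 [seq nat_of_ord (v (s a)) | a <- enum 'I_n.+1] i)%:R
  <= \sum_(s : 'S_n.+1) welfare t1 t2 X (fun k => grid R N (v k)) s.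
Proof.
have [tau [tauE tau_mono]] := grid_sort v.
rewrite (reindex_inj (mulIg tau)) /=; apply: ler_sum => s _.
apply: (welfare_ge t1 t2 _ s (fun i => wins T1 T2
  [seq nat_of_ord (v ((s * tau)%g a)) | a <- enum 'I_n.+1] i)).
move=> i; apply: wins_sold => //.
- move=> a b; rewrite !permM => vab; rewrite ltnNge; apply/negP => /tau_mono.
  by rewrite leqNgt vab.
- by move=> a; rewrite tauE ltr_grid permM.
- by move=> a; rewrite tauE ltr_grid permM.
Qed.

Lemma avg_welfare_ge :
  \sum_i X i * avg R N n.+1 (fun z => (wins T1 T2 z i)%:R)
  <= (\sum_(s : 'S_n.+1) (\sum_(v : {ffun 'I_n.+1 -> 'I_N})
        welfare t1 t2 X (fun k => grid R N (v k)) s) / N%:R ^+ n.+1) / n.+1`!%:R.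
Proof.
rewrite ler_pdivlMr ?ltr0n ?fact_gt0 // -mulr_suml ler_pdivlMr ?exprn_gt0 //.
rewrite [leRHS]exchange_big /=.
apply: le_trans; last by apply: ler_sum => v _; exact: sum_welfare_ge.
rewrite [leRHS]exchange_big /=; under [leRHS]eq_bigr => s _.
  rewrite exchange_big /=; under eq_bigr => i _.
    rewrite -mulr_sumr.
    have -> : \sum_(v : {ffun 'I_n.+1 -> 'I_N})
       (wins T1 T2 [seq nat_of_ord (v (s a)) | a <- enum 'I_n.+1] i)%:R
      = \sum_(v : {ffun 'I_n.+1 -> 'I_N})
       (wins T1 T2 [seq nat_of_ord (v a) | a <- enum 'I_n.+1] i)%:R :> R.
      (* Relabelling the agents permutes the assignments [v], so every order contributes the same
         amount. *)
      pose h (r : 'S_n.+1) (v : {ffun 'I_n.+1 -> 'I_N}) :=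
        [ffun a => v (r a)] : {ffun 'I_n.+1 -> 'I_N}.
      rewrite [RHS](reindex (h s)) /=.
        apply: eq_bigr => v _; congr (wins _ _ _ _)%:R.
        by apply: eq_map => a; rewrite ffunE.
      exists (h (s^-1)%g) => v _; apply/ffunP => a; rewrite !ffunE.
        by rewrite permKV.
      by rewrite permK.
    over.
  over.
rewrite sumr_const card_Sn -[leRHS]mulr_natr.
rewrite mulrAC; apply: ler_wpM2r; first exact: ler0n.
rewrite mulr_suml; apply: ler_sum => i _.
have /= <- := avg_ffun R N n.+1 (fun z => (wins T1 T2 z i)%:R).
by rewrite -mulrA divfK // gt_eqF // exprn_gt0.
Qed.

End GridWelfare.

(** * Lower bound for the probability that a given buyer wins *)

Section WinProb.
Variables (R : realFieldType) (N T1 T2 : nat).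
Hypothesis N_gt0 : (0 < N)%N.
Hypothesis T12 : (T1 <= T2)%N.
Hypothesis T2N : (T2 <= N)%N.

Definition cell_time (q : nat) : R := q.+1%:R / N%:R.

Local Notation x := cell_time.
Local Notation y q := (1 - cell_time q).

(** [alpha1] and [alpha2] are Riemann sums of max(t1, s) and of max(t1, s) max(t2, s) over the
    seller's arrival s before cell [q]. *)
Definition alpha1 (q : nat) : R :=
  (\sum_(0 <= p < q) (maxn T1 p)%:R / N%:R) / N%:R.

Definition alpha2 (q : nat) : R :=
  (\sum_(0 <= p < q) (maxn T1 p)%:R / N%:R * ((maxn T2 p)%:R / N%:R)) / N%:R.

(** The bounds [prob_wins1_ge] and [prob_wins2_ge], summed over the seller's cell and the cell [q]
    of a buyer with [i] better ones. *)
Definition win_lb (i : nat) : R :=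
  (\sum_(T1 <= q < T2) y q ^+ i * (alpha1 q / x q)) / N%:R +
  (\sum_(T2 <= q < N)
     (y q ^+ i / x q ^+ 2 + i%:R * y q ^+ i.-1 / x q) * alpha2 q) / N%:R.

(** Conditions on the cells of the seller and of buyer [i]; the remaining cells split into the [i]
    better buyers and the [n - i.+1] worse ones. *)
Lemma avg_winsE n i : (i < n)%N ->
  avg R N n.+1 (fun z => (wins T1 T2 z i)%:R) =
  (\sum_(p < N) (\sum_(q < N) ((p < q) && (T1 <= q))%N%:R *
     prob_wins R N q (bounds T1 T2 p q) i (n - i.+1)) / N%:R) / N%:R.
Proof.
move=> i_n /=; congr (_ / _); apply: eq_bigr => p _.
have {1}-> : n = (i + (n - i.+1).+1)%N by lia.
rewrite avg_cat mulr_suml.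
transitivity (avg R N i (fun L1 => \sum_(q < N) N%:R^-1 *
   (((p < q) && (T1 <= q))%N%:R * avg R N (n - i.+1) (fun L2 =>
     ((count (fun l => l <= q)%N L1 < size (bounds T1 T2 p q))%N
      && no_sale q (bounds T1 T2 p q) (L1 ++ L2))%:R)))).
  apply: eq_avg => L1 sL1 /=; rewrite mulr_suml; apply: eq_bigr => q _.
  rewrite mulrC -avgZ; congr (_ * _); apply: eq_avg => L2 _.
  rewrite /wins /= nth_cat sL1 ltnn subnn /= take_size_cat // drop_cat sL1.
  have -> : (i.+1 < i)%N = false by lia.
  rewrite subSn // subnn /= drop0 -natrM mulnb; congr (nat_of_bool _)%:R.
  by rewrite -!andbA.
rewrite avg_sum; apply: eq_bigr => q _.
by rewrite avgZ avgZ mulrC.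
Qed.

Let NR_gt0 : 0 < N%:R :> R. Proof. by rewrite ltr0n. Qed.

Lemma win_lb_le n i : (i < n)%N ->
  win_lb i <= avg R N n.+1 (fun z => (wins T1 T2 z i)%:R).
Proof.
move=> i_n; rewrite (avg_winsE _ _ i_n).
rewrite /win_lb -mulrDl ler_pM2r ?invr_gt0 //.
under [leRHS]eq_bigr => p _ do rewrite mulr_suml.
rewrite [leRHS]exchange_big /=.
pose G q : R := \sum_(p < N) ((p < q) && (T1 <= q))%N%:R *
     prob_wins R N q (bounds T1 T2 p q) i (n - i.+1) / N%:R.
rewrite -[leRHS](big_mkord xpredT G).
(* Pattern common to both ranges of [q]: only the factor [B] depends on the seller's cell. *)
have Gge q c A (B : nat -> R) : (q < N)%N -> (T1 <= q)%N ->
    c = A * ((\sum_(0 <= p < q) B p) / N%:R) ->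
    (forall p, (p < q)%N -> A * B p <= prob_wins R N q (bounds T1 T2 p q) i (n - i.+1)) ->
    c <= G q.
  move=> qN T1q -> AB; rewrite big_mkord (big_ord_widen N B (ltnW qN)) big_mkcond /=.
  rewrite mulrA mulr_sumr mulr_suml; apply: ler_sum => p _.
  rewrite ler_pM2r ?invr_gt0 // T1q andbT.
  case: (ltnP p q) => pq /=; first by rewrite mul1r AB.
  by rewrite mulr0 mul0r.
have T1N := leq_trans T12 T2N.
rewrite [leRHS](big_cat_nat (leq0n T1) T1N) /=.
rewrite [X in _ <= X + _]big_nat_cond [X in _ <= X + _]big1 ?add0r; last first.
  move=> q /andP[/andP[_ qT1] _]; rewrite /G big1 // => p _.
  by rewrite [(T1 <= q)%N]leqNgt qT1 andbF !mul0r.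
rewrite [leRHS](big_cat_nat T12 T2N) /=.
apply: lerD; rewrite big_nat_cond [leRHS]big_nat_cond; apply: ler_sum => q;
  rewrite andbT => /andP[Tq qT].
  apply: (Gge q _ (y q ^+ i / x q) (fun p => (maxn T1 p)%:R / N%:R)) => //.
  - exact: leq_trans T2N.
  - by rewrite /alpha1 mulrCA mulrC.
  - move=> p pq; rewrite /bounds qT -mulrA [_^-1 * _]mulrC.
    by apply: prob_wins1_ge; [exact: leq_trans T2N|rewrite leqW // geq_max Tq ltnW].
apply: (Gge q _ (y q ^+ i / x q ^+ 2 + i%:R * y q ^+ i.-1 / x q)
  (fun p => (maxn T1 p)%:R / N%:R * ((maxn T2 p)%:R / N%:R))) => //.
- exact: leq_trans Tq.
- move=> p pq; rewrite /bounds ltnNge Tq /=; apply: prob_wins2_ge => //.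
    by rewrite leqW // geq_max (leq_trans T12 Tq) ltnW.
  by rewrite leqW // geq_max Tq ltnW.
Qed.

End WinProb.

(** * Rounding the arrival times to a grid *)

Section Cell.
Local Open Scope classical_set_scope.
Variables (R : realType) (N : nat).
Hypothesis N_gt0 : (0 < N)%N.

Let NR_gt0 : 0 < N%:R :> R. Proof. by rewrite ltr0n. Qed.

Definition cell_nat (r : R) : nat :=
  #|[pred c : 'I_N.-1 | c.+1%:R / N%:R < r]|.

Lemma cell_subproof (r : R) : (cell_nat r < N)%N.
Proof.
by rewrite -(prednK N_gt0) ltnS -[leqRHS]card_ord max_card.
Qed.

(* The boundary points [c.+1 / N] that lie strictly below [r] are counted, so
   the cells are the intervals (c/N, (c+1)/N], the first and the last one being
   extended to infinity. *)
Definition cell (r : R) : 'I_N := Ordinal (cell_subproof r).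

(** Confined to interior boundary points, since the two outermost cells are unbounded. *)
Lemma leq_cell T r : (0 < T < N)%N -> (T <= cell r)%N = (T%:R / N%:R < r).
Proof.
move=> /andP[T0 TN]; have TN' : (T <= N.-1)%N by lia.
have cT : #|[pred c : 'I_N.-1 | (c < T)%N]| = T.
  by rewrite -sum1_card -(big_ord_widen N.-1 (fun=> 1%N) TN') sum1_card card_ord.
have cT' : #|[pred c : 'I_N.-1 | (c < T.-1)%N]| = T.-1.
  have TN2 : (T.-1 <= N.-1)%N by lia.
  by rewrite -sum1_card -(big_ord_widen N.-1 (fun=> 1%N) TN2) sum1_card card_ord.
case: ltP => Tr.
  rewrite -{1}cT; apply/subset_leq_card/fintype.subsetP => c; rewrite !inE => c_T.
  by apply: le_lt_trans Tr; rewrite ler_pM2r ?invr_gt0 // ler_nat.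
apply/negbTE; rewrite -ltnNge -(prednK T0) ltnS -cT'.
apply/subset_leq_card/fintype.subsetP => c; rewrite !inE => cr.
have := lt_le_trans cr Tr.
rewrite ltr_pM2r ?invr_gt0 // ltr_nat; lia.
Qed.

Lemma cell_mono r r' : r <= r' -> (cell r <= cell r')%N.
Proof.
move=> rr'; apply/subset_leq_card/fintype.subsetP => c; rewrite !inE => cr.
exact: lt_le_trans rr'.
Qed.

Lemma measurable_cell_ge T : (T <= N)%N -> measurable [set r | (T <= cell r)%N].
Proof.
rewrite leq_eqVlt => /orP[/eqP ->|TN].
  rewrite [X in measurable X](_ : _ = set0) // -subset0 => r /=.
  by rewrite leqNgt cell_subproof.
have [->|T0] := posnP T.
  by rewrite [X in measurable X](_ : _ = setT) // -subTset => r.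
rewrite [X in measurable X](_ : _ = `]T%:R / N%:R, +oo[%classic) //.
by apply/seteqP; split=> r /=; rewrite leq_cell ?T0 // in_itv /= andbT.
Qed.

Lemma uniform_cell_ge T : (T <= N)%N ->
  uniform_prob (@ltr01 R) [set r | (T <= cell r)%N] = (1 - T%:R / N%:R)%:E.
Proof.
rewrite leq_eqVlt => /orP[/eqP ->|TN].
  rewrite divff ?gt_eqF // subrr (_ : [set _ | _] = set0) ?measure0 //.
  by rewrite -subset0 => r /=; rewrite leqNgt cell_subproof.
have [->|T0] := posnP T.
  rewrite mul0r subr0 (_ : [set _ | _] = setT); first exact: probability_setT.
  by rewrite -subTset => r.
rewrite (_ : [set _ | _] = `]T%:R / N%:R, +oo[%classic); last first.
  by apply/seteqP; split=> r /=; rewrite leq_cell ?T0 // in_itv /= andbT.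
rewrite /uniform_prob integral_uniform_pdf.
have TN1 : T%:R / N%:R < 1 :> R by rewrite ltr_pdivrMr // mul1r ltr_nat.
rewrite (_ : (_ `&` _)%classic = `]T%:R / N%:R, 1]%classic); last first.
  apply/seteqP; split=> r /=; rewrite !in_itv /= ?andbT.
    by case=> -> /andP[_ ->].
  by move=> /andP[Tr ->]; rewrite Tr (le_trans _ (ltW Tr)) // divr_ge0 ?ler0n.
rewrite (eq_integral (fun=> 1%E)); last first.
  move=> r; rewrite inE /= in_itv /= => /andP[Tr r1].
  by rewrite /uniform_pdf r1 (le_trans _ (ltW Tr)) ?divr_ge0 ?ler0n // subr0 invr1.
by rewrite integral_cst //= mul1e lebesgue_measure_itv /= lte_fin TN1 EFinB.
Qed.

Lemma cell_setE (c : 'I_N) : [set r | cell r = c]%classic =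
  ([set r | (c <= cell r)%N] `\` [set r | (c.+1 <= cell r)%N])%classic.
Proof.
apply/seteqP; split=> r /= => [<-|[cr /negP]]; first by rewrite ltnn.
by rewrite -leqNgt => rc; apply/val_inj/eqP; rewrite eqn_leq rc.
Qed.

Lemma measurable_cell (c : 'I_N) : measurable [set r | cell r = c].
Proof.
rewrite cell_setE; apply: measurableD.
  exact: measurable_cell_ge c (ltnW (ltn_ord c)).
exact: measurable_cell_ge c.+1 (ltn_ord c).
Qed.

Lemma uniform_cell (c : 'I_N) :
  uniform_prob (@ltr01 R) [set r | cell r = c] = (N%:R^-1)%:E.
Proof.
have mc := measurable_cell_ge c (ltnW (ltn_ord c)).
have mc1 := measurable_cell_ge c.+1 (ltn_ord c).
rewrite cell_setE [LHS]measureD //; last first.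
  by rewrite [X in (X < _)%E](uniform_cell_ge c (ltnW (ltn_ord c))) ltry.
rewrite (_ : (_ `&` _)%classic = [set r | (c.+1 <= cell r)%N]).
  rewrite [X in (X - _)%E](uniform_cell_ge c (ltnW (ltn_ord c))).
  rewrite [X in (_ - X)%E](uniform_cell_ge c.+1 (ltn_ord c)) -EFinB.
  by congr _%:E; rewrite -natr1; field; rewrite gt_eqF.
by apply/seteqP; split=> r /= => [[]//|cr]; split => //; exact: ltnW.
Qed.

End Cell.

(** * The welfare depends only on the cells *)

Section Discretization.
Local Open Scope classical_set_scope.
Variables (R : realType) (n : nat) (X : 'I_n -> R).

(** A monotone map commutes with sorting; it is applied to the rounding to the grid. *)
Lemma arrival_time_homo (h : R -> R) (u : 'I_n.+1 -> R) s a :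
  {homo h : r r' / r <= r'} ->
  arrival_time (fun k => h (u k)) s a = h (arrival_time u s a).
Proof.
move=> h_mono; rewrite /arrival_time.
have -> : sort <=%R [seq h (u k) | k <- enum 'I_n.+1]
    = [seq h r | r <- sort <=%R [seq u k | k <- enum 'I_n.+1]].
  apply: (sorted_eq le_trans le_anti).
  - exact: sort_le_sorted.
  - by apply: (homo_sorted h_mono); exact: sort_le_sorted.
  - by rewrite perm_sort (map_comp h u) perm_map // perm_sym perm_sort.
by rewrite (nth_map 0) // size_sort size_map size_enum_ord.
Qed.

Lemma eq_welfare (t1 t2 : R) (u u' : 'I_n.+1 -> R) (s : 'S_n.+1) :
  (forall a, (t1 < arrival_time u s a) = (t1 < arrival_time u' s a)) ->
  (forall a, (t2 < arrival_time u s a) = (t2 < arrival_time u' s a)) ->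
  welfare t1 t2 X u s = welfare t1 t2 X u' s.
Proof.
move=> e1 e2; have acc : acceptable t1 t2 X u s =1 acceptable t1 t2 X u' s.
  by move=> i; rewrite /acceptable e1 e2.
rewrite /welfare (eq_pick (_ : _ =1 sold_to t1 t2 X u' s)) // => i.
rewrite /sold_to acc; congr (_ && _); apply: eq_forallb => j; by rewrite acc.
Qed.

Variables (N : nat) (N_gt0 : (0 < N)%N).

Lemma welfare_grid (T1 T2 : nat) (u : 'I_n.+1 -> R) (s : 'S_n.+1) :
  (0 < T1 < N)%N -> (0 < T2 < N)%N ->
  let t1 := T1%:R / N%:R in let t2 := T2%:R / N%:R in
  welfare t1 t2 X u s =
  welfare t1 t2 X (fun k => grid R N (cell R N N_gt0 (u k))) s.
Proof.
move=> T1N T2N t1 t2.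
have h_mono : {homo (fun r => grid R N (cell R N N_gt0 r)) : r r' / r <= r'}.
  by move=> r r' rr'; rewrite ler_grid //; exact: cell_mono.
by apply: eq_welfare => a;
  rewrite (arrival_time_homo (fun r => grid R N (cell R N N_gt0 r))) //
     ltr_grid // leq_cell.
Qed.

Variables (d : measure_display) (T : measurableType d) (P : probability T R).
Variable (U : 'I_n.+1 -> {RV P >-> R}).
Hypothesis U_uniform : forall k : 'I_n.+1, uniform01 (U k).
Hypothesis U_independent : mutually_independent U.

Let Y (w : T) : {ffun 'I_n.+1 -> 'I_N} := [ffun k => cell R N N_gt0 (U k w)].

Let YE v : Y @^-1` [set v] =
  \bigcap_(k in [set` [set: 'I_n.+1]%SET]) (U k @^-1` [set r | cell R N N_gt0 r = v k]).
Proof.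
apply/seteqP; split=> w /= => [<- k _ /=|Yw]; first by rewrite ffunE.
by apply/ffunP => k; rewrite ffunE; apply: Yw; rewrite /= inE.
Qed.

Let mY v : measurable (Y @^-1` [set v]).
Proof.
rewrite YE; apply: fin_bigcap_measurable => // k _.
rewrite -[X in measurable X]setTI; apply: measurable_funP => //.
exact: measurable_cell.
Qed.

Let PY v : P (Y @^-1` [set v]) = ((N%:R ^+ n.+1)^-1)%:E.
Proof.
rewrite YE U_independent => [|k]; last exact: measurable_cell.
rewrite (eq_bigr (fun=> (N%:R^-1 : R)%:E)) => [|k _].
  by rewrite prodEFin prodr_const cardsT card_ord exprVn.
have := U_uniform k _ (measurable_cell R N N_gt0 (v k)).
by rewrite uniform_cell.
Qed.

Lemma expectation_cells (g : {ffun 'I_n.+1 -> 'I_N} -> R) : (forall v, 0 <= g v) ->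
  ('E_P[(fun w : T => g [ffun k => cell R N N_gt0 (U k w)])])%E
  = ((\sum_v g v) / N%:R ^+ n.+1)%:E.
Proof.
move=> g0; rewrite unlock.
(* The integrand takes finitely many values: one indicator for each assignment of cells. *)
transitivity (\int[P]_w \sum_v ((g v)%:E * (\1_(Y @^-1` [set v]) w)%:E))%E.
  apply: eq_integral => w _; rewrite (bigD1 (Y w)) //= big1 => [|v vY].
    by rewrite indicE mem_set //= mule1 adde0.
  by rewrite indicE memNset ?mule0 //= => /eqP; rewrite eq_sym (negbTE vY).
rewrite ge0_integral_sum //; last 2 first.
- move=> v; apply: measurable_funeM; apply/measurable_EFinP.
  exact: measurable_indic.
- by move=> v w _; rewrite mule_ge0 // lee_fin.
rewrite mulr_suml -sumEFin; apply: eq_bigr => v _.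
rewrite ge0_integralZl ?lee_fin //; last 1 first.
  by apply/measurable_EFinP; exact: measurable_indic.
by rewrite integral_indic // setIT [X in (_ * X)%E](PY v).
Qed.

Hypothesis X_ge0 : forall i, 0 <= X i.

Lemma ALG_grid (T1 T2 : nat) : (0 < T1 < N)%N -> (0 < T2 < N)%N ->
  let t1 := T1%:R / N%:R in let t2 := T2%:R / N%:R in
  ALG t1 t2 X U =
  (\sum_(s : 'S_n.+1) (\sum_(v : {ffun 'I_n.+1 -> 'I_N})
      welfare t1 t2 X (fun k => grid R N (v k)) s) / N%:R ^+ n.+1) / n.+1`!%:R.
Proof.
move=> T1N T2N t1 t2; rewrite /ALG; congr (_ / _); apply: eq_bigr => s _.
have w_ge0 (v : {ffun 'I_n.+1 -> 'I_N}) :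
    0 <= welfare t1 t2 X (fun k => grid R N (v k)) s.
  by rewrite /welfare; case: pickP.
rewrite (_ : (fun w => _) = (fun w : T =>
  welfare t1 t2 X (fun k => grid R N ([ffun k => cell R N N_gt0 (U k w)] k)) s)).
  by rewrite (expectation_cells _ w_ge0).
apply/funext => w; rewrite (welfare_grid T1 T2) //.
by congr (welfare _ _ _ _ _); apply/funext => k; rewrite ffunE.
Qed.

End Discretization.

(** * Riemann sums *)

(** Adding 2/n! to the partial sums makes them decreasing from n = 1 on, so that the tenth such
    value bounds all later partial sums. *)
Lemma expR1_le (R : realType) : expR 1 <= 271829%:R / 10 ^+ 5 :> R.
Proof.
pose S n : R := series (exp_coeff 1) n; pose B n : R := S n + 2 / n`!%:R.
have SS n : S n.+1 = S n + (n`!%:R)^-1.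
  by rewrite /S seriesSr /exp_coeff /= expr1n mul1r.
have Bdecr n k : (0 < n)%N -> B (n + k)%N <= B n.
  move=> n0; elim: k => [|k IH]; first by rewrite addn0.
  apply: le_trans IH; rewrite addnS /B SS factS natrM invfM.
  have : 2 * ((n + k).+1%:R)^-1 <= 1 :> R.
    by rewrite ler_pdivrMr ?ltr0n // mul1r ler_nat ltnS addn_gt0 n0.
  have : 0 <= ((n + k)`!%:R)^-1 :> R by rewrite invr_ge0.
  by set a := _^-1; set b := _^-1; nra.
have S0 : S 0 = 0 by rewrite /S /series /= big_geq.
have B10 : B 10%N <= 271829%:R / 10 ^+ 5.
  (* An abstract sequence with the recurrence of the inverse factorials keeps the arithmetic
     rational and small. *)
  have [r [rE r0 rS]] : exists r : nat -> R, [/\ forall k, (k`!%:R)^-1 = r k,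
      r 0 = 1 & forall k, r k.+1 = r k / k.+1%:R].
    exists (fun k => (k`!%:R)^-1); split=> // [|k]; first by rewrite fact0 invr1.
    by rewrite factS natrM invfM mulrC.
  have SrS k : S k.+1 = S k + r k by rewrite SS rE.
  by rewrite /B rE !SrS S0 !rS r0; lra.
have SB n : S n <= B n by rewrite lerDl divr_ge0 ?ler0n.
apply: le_trans B10; apply: limr_le; first exact: is_cvg_series_exp_coeff.
near=> m; apply: le_trans (SB m) _.
have m10 : (10 <= m)%N by near: m; exists 10%N.
by have := Bdecr 10%N (m - 10)%N isT; rewrite subnKC.
Unshelve. all: by end_near.
Qed.

(** Comes from exp z >= 1 + z at z = 1 - ln(b/a), which is sharp for b/a = e. The ratio t2/t1 is
    about 2.71827, so almost nothing is lost. *)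
Lemma ln_ratio_ge (R : realType) (a b : R) : 0 < a -> 0 < b ->
  2 - a / b * (271829%:R / 10 ^+ 5) <= ln b - ln a.
Proof.
move=> a0 b0; have := @expR_ge1Dx R (1 - (ln b - ln a)).
have -> : expR (1 - (ln b - ln a)) = expR 1 * (a / b).
  by rewrite opprB addrC expRD expRB !lnK ?posrE // mulrC.
have : expR 1 * (a / b) <= 271829%:R / 10 ^+ 5 * (a / b).
  by rewrite ler_wpM2r ?expR1_le // divr_ge0 // ltW.
by lra.
Qed.

Section LowerRiemann.
Local Open Scope classical_set_scope.
Variable R : realType.
Implicit Types (t x h : R) (F f : R -> R).

(* [F] grows at most as fast as the right-endpoint sums of [f] on [t, 1], up to
   an error that is quadratic in the mesh. *)
Definition primitive_le t F f :=
  exists2 C, 0 <= C & forall x h, 0 <= h -> t <= x - h -> x <= 1 ->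
    F x - F (x - h) <= h * f x + C * h ^+ 2.

Lemma primitive_leD t F f G g : primitive_le t F f -> primitive_le t G g ->
  primitive_le t (fun x => F x + G x) (fun x => f x + g x).
Proof.
move=> [C C0 HF] [K K0 HG]; exists (C + K); first exact: addr_ge0.
move=> x h h0 tx x1; have := HF x h h0 tx x1; have := HG x h h0 tx x1; lra.
Qed.

Lemma primitive_leZ t a F f : 0 <= a -> primitive_le t F f ->
  primitive_le t (fun x => a * F x) (fun x => a * f x).
Proof.
move=> a0 [C C0 HF]; exists (a * C); first exact: mulr_ge0.
move=> x h h0 tx x1; rewrite -mulrBr mulrCA -mulrA -mulrDr.
by rewrite ler_wpM2l // HF.
Qed.

Lemma primitive_le_cst t c : primitive_le t ( *%R c) (fun=> c).
Proof. by exists 0 => // x h _ _ _; lra. Qed.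

Lemma primitive_le_id t : primitive_le t (fun x => x ^+ 2 / 2) id.
Proof. by exists 0 => // x h _ _ _ /=; nra. Qed.

Lemma primitive_le_sqr t : 0 < t ->
  primitive_le t (fun x => - (x ^+ 3 / 3)) (fun x => - x ^+ 2).
Proof.
move=> t0; exists 1 => // x h h0 tx x1.
have -> : - (x ^+ 3 / 3) - - ((x - h) ^+ 3 / 3)
  = h * - x ^+ 2 + x * h ^+ 2 - h ^+ 3 / 3 by field.
have : 0 <= h ^+ 3 by rewrite exprn_ge0.
have : 0 <= h ^+ 2 by rewrite exprn_ge0.
by nra.
Qed.

(** By ln r <= r - 1 for r = x/(x - h), the excess over h/x is at most h^2/(x (x - h)), hence at
    most h^2/t^2. *)
Lemma primitive_le_ln t : 0 < t -> primitive_le t (@ln R) (fun x => x^-1).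
Proof.
move=> t0; exists ((t ^+ 2)^-1); first by rewrite invr_ge0 exprn_ge0 // ltW.
move=> x h h0 tx x1; have u0 : 0 < x - h := lt_le_trans t0 tx.
have x0 : 0 < x by lra.
have lnu : ln x - ln (x - h) <= x / (x - h) - 1.
  have r0 : 0 < x / (x - h) by rewrite divr_gt0.
  rewrite -ln_div ?posrE //; have := @le_ln1Dx R (x / (x - h) - 1).
  by rewrite subrKC; apply; lra.
apply: le_trans lnu _.
have -> : x / (x - h) - 1 = h * x^-1 + h ^+ 2 * (x * (x - h))^-1.
  by field; rewrite !gt_eqF.
rewrite lerD2l mulrC ler_wpM2r ?exprn_ge0 // lef_pV2 ?posrE ?exprn_gt0 ?mulr_gt0 //.
by rewrite expr2; apply: ler_pM; lra.
Qed.

Lemma primitive_le_inv2 t : 0 < t ->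
  primitive_le t (fun x => - x^-1) (fun x => (x ^+ 2)^-1).
Proof.
move=> t0; exists ((t ^+ 3)^-1); first by rewrite invr_ge0 exprn_ge0 // ltW.
move=> x h h0 tx x1; have u0 : 0 < x - h := lt_le_trans t0 tx.
have x0 : 0 < x by lra.
have -> : - x^-1 - - (x - h)^-1 = h * (x ^+ 2)^-1 + h ^+ 2 * (x ^+ 2 * (x - h))^-1.
  by field; rewrite !gt_eqF.
rewrite lerD2l mulrC ler_wpM2r ?exprn_ge0 // lef_pV2 ?posrE ?exprn_gt0 ?mulr_gt0 ?exprn_gt0 //.
rewrite exprSr; apply: ler_pM => //; rewrite ?exprn_ge0 ?(ltW t0) //.
by rewrite lerXn2r ?nnegrE //; lra.
Qed.

Lemma primitive_le_inv3 t : 0 < t ->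
  primitive_le t (fun x => - (2 * x ^+ 2)^-1) (fun x => (x ^+ 3)^-1).
Proof.
move=> t0; exists (3 / (2 * t ^+ 5)).
  by rewrite divr_ge0 ?mulr_ge0 ?exprn_ge0 // ltW.
move=> x h h0 tx x1; have u0 : 0 < x - h := lt_le_trans t0 tx.
have x0 : 0 < x by lra.
have -> : - (2 * x ^+ 2)^-1 - - (2 * (x - h) ^+ 2)^-1
   = h * (x ^+ 3)^-1 + (3 * (x - h) + h) / (2 * (x ^+ 3 * (x - h) ^+ 2)) * h ^+ 2.
  by field; rewrite !gt_eqF.
rewrite lerD2l ler_wpM2r ?exprn_ge0 //.
have tX k y : t <= y -> t ^+ k <= y ^+ k.
  by move=> ty; rewrite lerXn2r ?nnegrE //; lra.
apply: ler_pM; try lra; first by rewrite invr_ge0 !mulr_ge0 ?exprn_ge0 // ltW.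
rewrite lef_pV2 ?posrE ?mulr_gt0 ?exprn_gt0 // ler_pM2l // (exprD t 3 2).
by apply: ler_pM; rewrite ?exprn_ge0 ?(ltW t0) //; apply: tX => //; lra.
Qed.

(** The increments of [F] telescope; at most N cells have an error of C/N^2 each. *)
Lemma riemann_sum_ge t F f : primitive_le t F f -> exists2 C, 0 <= C &
  forall N a b : nat, (0 < N)%N -> (a <= b <= N)%N -> t <= a%:R / N%:R ->
  F (b%:R / N%:R) - F (a%:R / N%:R) - C / N%:R
  <= (\sum_(a <= q < b) f (cell_time R N q)) / N%:R.
Proof.
move=> [C C0 HF]; exists C => // N a b N0 /andP[ab bN] ta.
have NR0 : 0 < N%:R :> R by rewrite ltr0n.
apply: le_trans (_ : \sum_(a <= q < b)
   ((F (q.+1%:R / N%:R) - F (q%:R / N%:R)) - C / N%:R ^+ 2) <= _).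
  rewrite sumrB telescope_sumr // sumr_const_nat lerD2l lerN2 -[leLHS]mulr_natr.
  have -> : C / N%:R = C / N%:R ^+ 2 * N%:R by field; rewrite gt_eqF.
  apply: ler_wpM2l; first by rewrite divr_ge0 // exprn_ge0 // ltW.
  by rewrite ler_nat; lia.
rewrite mulr_suml big_nat_cond [leRHS]big_nat_cond; apply: ler_sum => q.
rewrite andbT => /andP[aq qb]; rewrite lerBlDr.
have := HF (q.+1%:R / N%:R) (N%:R^-1).
have -> : q.+1%:R / N%:R - N%:R^-1 = q%:R / N%:R :> R.
  by rewrite -natr1 mulrDl mul1r addrK.
move=> /(_ _ _ _)/le_trans; apply.
- by rewrite invr_ge0 ltW.
- by apply: le_trans ta _; rewrite ler_pM2r ?invr_gt0 // ler_nat.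
- by rewrite ler_pdivrMr // mul1r ler_nat (leq_trans qb).
- by rewrite /cell_time exprVn mulrC.
Qed.

End LowerRiemann.

(** * Closed forms for the sums over the seller's cell *)

Section Alpha.
Variables (R : realFieldType) (N T1 T2 : nat).
Hypothesis N_gt0 : (0 < N)%N.
Hypothesis T12 : (T1 <= T2)%N.
Hypothesis T2N : (T2 <= N)%N.

Local Notation t1 := (T1%:R / N%:R : R).
Local Notation t2 := (T2%:R / N%:R : R).
Local Notation x := (cell_time R N).

Let NR_gt0 : 0 < N%:R :> R. Proof. by rewrite ltr0n. Qed.

Lemma sum_maxn q : (T1 <= q)%N ->
  \sum_(0 <= p < q) (maxn T1 p)%:R = (T1%:R ^+ 2 + q%:R ^+ 2 - q%:R + T1%:R) / 2 :> R.
Proof.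
elim: q => [|q IH]; rewrite ?leqn0.
  by move=> /eqP ->; rewrite big_geq //; field.
rewrite leq_eqVlt => /orP[/eqP <-|]; last first.
  rewrite ltnS => T1q; rewrite big_nat_recr //= IH // (maxn_idPr T1q).
  by rewrite -natr1; field.
rewrite big_nat_cond (eq_bigr (fun=> T1%:R)) => [|p /andP[/andP[_ pT] _]].
  by rewrite -big_nat_cond sumr_const_nat subn0 -[LHS]mulr_natr; field.
by rewrite (maxn_idPl (ltnW pT)).
Qed.

(** At [q = T2] the second factor is constantly [T2], so that [sum_maxn] gives the base case. *)
Lemma sum_maxn2 q : (T2 <= q)%N ->
  \sum_(0 <= p < q) (maxn T1 p)%:R * (maxn T2 p)%:R
  = (3 * T2%:R * T1%:R ^+ 2 + T2%:R ^+ 3 + 3 * T1%:R * T2%:R - T2%:R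
     + 2 * q%:R ^+ 3 - 3 * q%:R ^+ 2 + q%:R) / 6 :> R.
Proof.
elim: q => [|q IH]; rewrite ?leqn0.
  by move=> /eqP T20; rewrite big_geq // T20; field.
rewrite leq_eqVlt => /orP[/eqP <-|]; last first.
  rewrite ltnS => T2q; rewrite big_nat_recr //= IH // (maxn_idPr T2q).
  by rewrite (maxn_idPr (leq_trans T12 T2q)) -natr1; field.
rewrite big_nat_cond (eq_bigr (fun p => (maxn T1 p)%:R * T2%:R)) => [|p /andP[/andP[_ pT] _]].
  by rewrite -big_nat_cond -mulr_suml sum_maxn //; field.
by rewrite (maxn_idPl (ltnW pT)).
Qed.

(** The main term exceeds the sum by (3q + 1 - T1)/(2 N^2), which is at most 3/(2N). *)
Lemma alpha1_ge q : (T1 <= q < N)%N ->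
  (x q ^+ 2 + t1 ^+ 2) / 2 - 3 / 2 / N%:R <= alpha1 R N T1 q.
Proof.
move=> /andP[Tq qN]; rewrite /alpha1 -mulr_suml sum_maxn // /cell_time -[q.+1%:R]natr1.
have qN' : q%:R + 1 <= N%:R :> R by rewrite natr1 ler_nat.
have -> : ((q%:R + 1) / N%:R) ^+ 2 + t1 ^+ 2 = ((q%:R + 1) ^+ 2 + T1%:R ^+ 2) / N%:R ^+ 2.
  by field; rewrite gt_eqF.
have -> : 3 / 2 / N%:R = 3 / 2 * N%:R / N%:R ^+ 2 :> R by field; rewrite gt_eqF.
rewrite -[leRHS]mulrA -invfM -expr2 mulrAC -mulrBl ler_pM2r ?invr_gt0 ?exprn_gt0 //.
have : 0 <= T1%:R :> R by [].
have : 0 <= q%:R :> R by [].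
by nra.
Qed.

Lemma alpha2_ge q : (T2 <= q < N)%N ->
  t2 * t1 ^+ 2 / 2 + t2 ^+ 3 / 6 + x q ^+ 3 / 3 - 3 / N%:R <= alpha2 R N T1 T2 q.
Proof.
move=> /andP[Tq qN]; rewrite /alpha2.
under eq_bigr => p _ do rewrite mulrACA.
rewrite -mulr_suml sum_maxn2 // /cell_time -[q.+1%:R]natr1.
have qN' : q%:R + 1 <= N%:R :> R by rewrite natr1 ler_nat.
have T2N' : T2%:R <= N%:R :> R by rewrite ler_nat.
have N1 : 1 <= N%:R :> R by rewrite ler1n.
set n := N%:R in qN' T2N' N1 *; have n0 : 0 < n by rewrite /n.
have := ler0n R T1; have := ler0n R T2; have := ler0n R q.
move: (T1%:R) (T2%:R) (q%:R) qN' T2N' => a b c cn bn c0 b0 a0.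
have -> : b / n * (a / n) ^+ 2 / 2 + (b / n) ^+ 3 / 6 + ((c + 1) / n) ^+ 3 / 3 - 3 / n
  = (3 * b * a ^+ 2 + b ^+ 3 + 2 * (c + 1) ^+ 3 - 18 * n ^+ 2) / 6 * (n^-1 * n^-1) / n.
  by field; rewrite gt_eqF.
do 2 (rewrite ler_pM2r ?mulr_gt0 ?invr_gt0 //).
rewrite ler_pM2r ?invr_gt0 //.
have : 0 <= a * b by rewrite mulr_ge0.
have : (c + 1) ^+ 2 <= n ^+ 2 by rewrite lerXn2r ?nnegrE ?addr_ge0 // ltW.
have : n <= n ^+ 2 by rewrite expr2 ler_peMl // ltW.
by nra.
Qed.

End Alpha.

(** * Summation over the k best buyers *)

Section WinSum.
Variables (R : realFieldType).
Implicit Types (t D x : R).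

(** [weight1] and [weight2] are the closed forms of the factors of [win_lb] that depend on [i],
    summed over [i < k]. *)
Definition weight1 (k : nat) x : R := (1 - (1 - x) ^+ k) / x.

Definition weight2 (k : nat) x : R :=
  (2 - 2 * (1 - x) ^+ k - k%:R * x * (1 - x) ^+ k.-1) / x ^+ 3.

Lemma sum_weight1 k x : x != 0 -> \sum_(i < k) (1 - x) ^+ i = weight1 k x.
Proof.
move=> x0; elim: k => [|k IH]; first by rewrite big_ord0 /weight1 expr0 subrr mul0r.
by rewrite big_ord_recr /= IH /weight1 exprSr; field.
Qed.

Lemma sum_weight2 k x : x != 0 ->
  \sum_(i < k) ((1 - x) ^+ i / x ^+ 2 + i%:R * (1 - x) ^+ i.-1 / x) = weight2 k x.
Proof.
move=> x0; elim: k => [|k IH].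
  by rewrite big_ord0 /weight2 expr0 !mul0r subr0 mulr1 subrr mul0r.
rewrite big_ord_recr /= IH /weight2; case: k {IH} => [|k] /=.
  by rewrite !expr0; field.
rewrite -!natr1 (exprSr (1 - x) k.+1) !(exprSr (1 - x) k); field; exact: x0.
Qed.

Lemma weight1_ge0 k x : 0 < x <= 1 -> 0 <= weight1 k x.
Proof.
move=> /andP[x0 x1]; rewrite -sum_weight1 ?gt_eqF //; apply: sumr_ge0 => i _.
by rewrite exprn_ge0 // subr_ge0.
Qed.

Lemma weight2_ge0 k x : 0 < x <= 1 -> 0 <= weight2 k x.
Proof.
move=> /andP[x0 x1]; have x0' := ltW x0.
have y0 : 0 <= 1 - x by rewrite subr_ge0.
rewrite -sum_weight2 ?gt_eqF //; apply: sumr_ge0 => i _.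
by rewrite addr_ge0 // divr_ge0 ?mulr_ge0 ?exprn_ge0.
Qed.

Lemma weight1_le k x : 0 < x <= 1 -> weight1 k x <= x^-1.
Proof.
move=> /andP[x0 x1]; rewrite /weight1 ler_piMl ?invr_ge0 ?(ltW x0) //.
by rewrite gerBl exprn_ge0 // subr_ge0.
Qed.

Lemma weight2_le k x : 0 < x <= 1 -> weight2 k x <= 2 / x ^+ 3.
Proof.
move=> /andP[x0 x1]; have x0' := ltW x0.
have y0 : 0 <= 1 - x by rewrite subr_ge0.
rewrite /weight2 ler_pM2r ?invr_gt0 ?exprn_gt0 // -addrA gerDl -opprD oppr_le0.
by rewrite addr_ge0 ?mulr_ge0 ?exprn_ge0.
Qed.

End WinSum.

Section WinSumBound.
Variable R : realType.

Lemma inv_succ_ge k : 3 / 4 * (3 / k.+3%:R) <= 3 / k.+4%:R :> R.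
Proof.
rewrite -[k.+4%:R]natr1; have : 3 <= k.+3%:R :> R by rewrite ler_nat.
move: (k.+3%:R) => K K3; have K0 : 0 < K by lra.
rewrite ler_pdivlMr; last by lra.
have -> : 3 / 4 * (3 / K) * (K + 1) = 9 / 4 + 9 / 4 / K by field; rewrite gt_eqF.
suff : 9 / 4 / K <= 3 / 4 by lra.
by rewrite ler_pdivrMr //; lra.
Qed.

(** Equality holds at [k = 0]; each step multiplies the left side by y <= 3/4 and the right side by
    at least 3/4, by [inv_succ_ge]. *)
Lemma expr_interp k (y : R) : 0 <= y <= 3 / 4 ->
  y ^+ k.+2 <= 3 / k.+3%:R * y ^+ 2.
Proof.
move=> /andP[y0 y1]; elim: k => [|k IH]; first by rewrite divff ?mul1r.
rewrite exprS; apply: le_trans (_ : 3 / 4 * (3 / k.+3%:R * y ^+ 2) <= _).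
  by apply: ler_pM => //; exact: exprn_ge0.
by rewrite mulrA ler_wpM2r ?exprn_ge0 ?inv_succ_ge.
Qed.

(** For y = 1 - x the left side is 2 minus the numerator of [weight2] at [k.+2]. It equals 2y at
    [k = 0] and shrinks at least by the factor 3/4 in each step. *)
Lemma expr2_interp k (y : R) : 0 <= y <= 1 / 5 ->
  2 * y ^+ k.+2 + k.+2%:R * (1 - y) * y ^+ k.+1 <= 3 / k.+3%:R * (2 * y).
Proof.
move=> /andP[y0 y1]; elim: k => [|k IH].
  by rewrite divff ?mul1r // le_eqVlt; apply/orP; left; apply/eqP; ring.
set B := 2 * y ^+ k.+2 + _ in IH; have B0 : 0 <= B.
  have y1' : 0 <= 1 - y by lra.
  apply: addr_ge0; apply: mulr_ge0; rewrite ?exprn_ge0 ?mulr_ge0 //.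
apply: le_trans (_ : 3 / 4 * B <= _).
  have -> : k.+3%:R = k.+2%:R + 1 :> R by rewrite natr1.
  rewrite /B (exprS y k.+2) (exprS y k.+1).
  have : 2 <= k.+2%:R :> R by rewrite ler_nat.
  have : 0 <= y ^+ k.+1 by rewrite exprn_ge0.
  move: (k.+2%:R) (y ^+ k.+1) => K z z0 K2.
  have -> : 2 * (y * (y * z)) + (K + 1) * (1 - y) * (y * z)
    = z * (2 * (y * y) + (K + 1) * y * (1 - y)) by ring.
  have -> : 3 / 4 * (2 * (y * z) + K * (1 - y) * z)
    = z * (3 / 4 * (2 * y) + 3 / 4 * K * (1 - y)) by ring.
  rewrite ler_wpM2l // lerD //; first by nra.
  by rewrite ler_wpM2r //; [lra | nra].
apply: le_trans (_ : 3 / 4 * (3 / k.+3%:R * (2 * y)) <= _); first by rewrite ler_pM2l.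
by rewrite mulrA ler_wpM2r ?inv_succ_ge // mulr_ge0.
Qed.

End WinSumBound.

Section WinSumLimit.
Variable R : realType.

Definition riemann (N a b : nat) (f : R -> R) : R :=
  (\sum_(a <= q < b) f (cell_time R N q)) / N%:R.

Lemma ler_riemann N a b e (f : R -> R) (g : nat -> R) : (0 < N)%N -> (b <= N)%N ->
  0 <= e -> (forall q, (a <= q < b)%N -> f (cell_time R N q) - e <= g q) ->
  riemann N a b f - e <= (\sum_(a <= q < b) g q) / N%:R.
Proof.
move=> N0 bN e0 fg; have NR0 : 0 < N%:R :> R by rewrite ltr0n.
apply: le_trans (_ : (\sum_(a <= q < b) (f (cell_time R N q) - e)) / N%:R <= _).
  rewrite sumrB sumr_const_nat mulrBl lerD2l lerN2 ler_pdivrMr // -[leLHS]mulr_natr.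
  by apply: ler_wpM2l => //; rewrite ler_nat; lia.
rewrite ler_pM2r ?invr_gt0 // big_nat_cond [leRHS]big_nat_cond.
by apply: ler_sum => q; rewrite andbT; exact: fg.
Qed.

Lemma ler_riemannW N a b (f g : R -> R) : (0 < N)%N ->
  (forall q, (a <= q < b)%N -> f (cell_time R N q) <= g (cell_time R N q)) ->
  riemann N a b f <= riemann N a b g.
Proof.
move=> N0 fg; rewrite /riemann ler_pM2r ?invr_gt0 ?ltr0n //.
rewrite big_nat_cond [leRHS]big_nat_cond.
by apply: ler_sum => q; rewrite andbT; exact: fg.
Qed.

Lemma riemann_comb N a b (c c' : R) (f g : R -> R) :
  riemann N a b (fun x => c * f x + c' * g x) = c * riemann N a b f + c' * riemann N a b g.
Proof. by rewrite /riemann big_split -!mulr_sumr mulrDl !mulrA. Qed.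

Lemma cell_time_le1 N q : (q < N)%N -> cell_time R N q <= 1.
Proof.
move=> qN; rewrite ler_pdivrMr ?mul1r ?ler_nat // ltr0n; exact: leq_ltn_trans qN.
Qed.

Lemma cell_time_ge N T q : (T <= q < N)%N -> T%:R / N%:R <= cell_time R N q.
Proof.
move=> /andP[Tq qN]; rewrite ler_pM2r ?ler_nat ?(leqW Tq) // invr_gt0 ltr0n.
exact: leq_ltn_trans qN.
Qed.

Variables t1 t2 : R.
Hypothesis t1_gt0 : 0 < t1.

Let D : R := t2 * t1 ^+ 2 / 2 + t2 ^+ 3 / 6.

(* The limits, as the grid gets finer, of [alpha1] divided by [x] and of [alpha2]. *)
Definition density1 x : R := (x ^+ 2 + t1 ^+ 2) / 2 / x.
Definition density2 x : R := D + x ^+ 3 / 3.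

Definition grid_bound N T1 T2 (w1 w2 : R -> R) : R :=
  riemann N T1 T2 (fun x => w1 x * density1 x) +
  riemann N T2 N (fun x => w2 x * density2 x).

(** The error is uniform in [k] because the weights never exceed their limits 1/x and 2/x^3, which
    are bounded on [t1, 1]. *)
Lemma sum_win_lb_ge : exists2 C, 0 <= C & forall N T1 T2 k : nat, (0 < N)%N ->
  (T1 <= T2 <= N)%N -> T1%:R / N%:R = t1 -> T2%:R / N%:R = t2 ->
  grid_bound N T1 T2 (weight1 R k) (weight2 R k) - C / N%:R
  <= \sum_(i < k) win_lb R N T1 T2 i.
Proof.
have t1V : 0 <= (t1 ^+ 2)^-1 by rewrite invr_ge0 exprn_ge0 // ltW.
have t1V3 : 0 <= (t1 ^+ 3)^-1 by rewrite invr_ge0 exprn_ge0 // ltW.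
exists ((t1 ^+ 2)^-1 * (3 / 2) + 2 * (t1 ^+ 3)^-1 * 3).
  by rewrite addr_ge0 // !mulr_ge0.
move=> N T1 T2 k N0 /andP[T12 T2N] t1E t2E.
have NR0 : 0 < N%:R :> R by rewrite ltr0n.
have x_gt0 q : 0 < cell_time R N q by rewrite divr_gt0 // ltr0n.
have tX m q : (T1 <= q < N)%N -> t1 ^+ m <= cell_time R N q ^+ m.
  move=> Tq; rewrite lerXn2r ?nnegrE ?(ltW t1_gt0) ?(ltW (x_gt0 q)) //.
  by rewrite -t1E cell_time_ge.
have -> : \sum_(i < k) win_lb R N T1 T2 i =
    (\sum_(T1 <= q < T2) weight1 R k (cell_time R N q) *
        (alpha1 R N T1 q / cell_time R N q)) / N%:R +
    (\sum_(T2 <= q < N) weight2 R k (cell_time R N q) * alpha2 R N T1 T2 q) / N%:R.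
  rewrite /win_lb big_split -!mulr_suml /= exchange_big [in X in _ + X]exchange_big /=.
  congr (_ / _ + _ / _); apply: eq_bigr => q _; rewrite -mulr_suml.
    by rewrite sum_weight1 // gt_eqF.
  by rewrite sum_weight2 // gt_eqF.
rewrite /grid_bound mulrDl opprD addrACA; apply: lerD; apply: ler_riemann => //.
- by rewrite !mulr_ge0 // invr_ge0 ltW.
- move=> q /andP[Tq qT]; set x := cell_time R N q.
  have qN : (q < N)%N := leq_trans qT T2N.
  have x0 : 0 < x := x_gt0 q.
  have x01 : 0 < x <= 1 by rewrite x0 cell_time_le1.
  have := alpha1_ge R N T1 N0 q; rewrite Tq qN t1E => /(_ isT) a_ge.
  have w_ge0 : 0 <= weight1 R k x / x by rewrite divr_ge0 ?weight1_ge0 // ltW.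
  have w_le : weight1 R k x / x <= (t1 ^+ 2)^-1.
    apply: le_trans (_ : x^-1 / x <= _).
      by rewrite ler_pM2r ?invr_gt0 // weight1_le.
    rewrite -invfM -expr2 lef_pV2 ?posrE ?exprn_gt0 //; apply: tX.
    by rewrite Tq.
  have e0 : 0 <= 3 / 2 / N%:R :> R by rewrite !mulr_ge0 // invr_ge0 ltW.
  have := ler_wpM2l w_ge0 a_ge; have := ler_wpM2r e0 w_le.
  have wE z : weight1 R k x * (z / x) = weight1 R k x / x * z by rewrite mulrA mulrAC.
  rewrite /density1 -/x !wE.
  move: (weight1 R k x / x) (alpha1 R N T1 q) ((t1 ^+ 2)^-1) => w a v.
  by lra.
- by rewrite !mulr_ge0 // invr_ge0 ltW.
- move=> q /andP[Tq qN]; set x := cell_time R N q.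
  have x0 : 0 < x := x_gt0 q.
  have x01 : 0 < x <= 1 by rewrite x0 cell_time_le1.
  have := alpha2_ge R N T1 T2 N0 T12 T2N q.
  rewrite Tq qN t1E t2E -/x => /(_ isT) a_ge.
  have w_le : weight2 R k x <= 2 * (t1 ^+ 3)^-1.
    apply: le_trans (weight2_le _ _ _ x01) _; rewrite ler_pM2l //.
    by rewrite lef_pV2 ?posrE ?exprn_gt0 // tX // qN (leq_trans T12).
  have e0 : 0 <= 3 / N%:R :> R by rewrite mulr_ge0 // invr_ge0 ltW.
  have := ler_wpM2l (weight2_ge0 _ k _ x01) a_ge; have := ler_wpM2r e0 w_le.
  rewrite /density2 /D -/x; move: (weight2 R k x) (alpha2 R N T1 T2 q) => w a.
  by rewrite !mulrA; lra.
Qed.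

End WinSumLimit.

(** * The integrals for the given thresholds *)

Section Limits.
Variable R : realType.

Lemma grid_bound_ge (t1 t2 : R) (w1 w2 f1 f2 F1 F2 : R -> R) : 0 < t1 ->
  (forall x, 0 < x -> w1 x * density1 R t1 x = f1 x) ->
  (forall x, 0 < x -> w2 x * density2 R t1 t2 x = f2 x) ->
  primitive_le R t1 F1 f1 -> primitive_le R t1 F2 f2 ->
  exists2 C, 0 <= C & forall N T1 T2 : nat, (0 < N)%N ->
    (T1 <= T2 <= N)%N -> T1%:R / N%:R = t1 -> T2%:R / N%:R = t2 ->
    F1 t2 - F1 t1 + (F2 1 - F2 t2) - C / N%:R <= grid_bound R t1 t2 N T1 T2 w1 w2.
Proof.
move=> t1_gt0 wf1 wf2 /riemann_sum_ge[C1 C10 H1] /riemann_sum_ge[C2 C20 H2].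
exists (C1 + C2); first exact: addr_ge0.
move=> N T1 T2 N0 /andP[T12 T2N] t1E t2E; have NR0 : 0 < N%:R :> R by rewrite ltr0n.
have x_gt0 q : 0 < cell_time R N q by rewrite divr_gt0 // ltr0n.
rewrite /grid_bound mulrDl opprD addrACA; apply: lerD.
  have := H1 N T1 T2 N0; rewrite T12 T2N t1E t2E lexx => /(_ isT isT)/le_trans; apply.
  by apply: ler_riemannW => // q _; rewrite wf1.
have t12 : t1 <= t2 by rewrite -t1E -t2E ler_pM2r ?invr_gt0 // ler_nat.
have := H2 N T2 N N0; rewrite T2N leqnn t2E divff ?gt_eqF //.
move=> /(_ isT t12)/le_trans; apply.
by apply: ler_riemannW => // q _; rewrite wf2.
Qed.

Variables c t1 t2 : R.
Hypothesis cE : c = 1836835%:R / 10 ^+ 6.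
Hypothesis t1E : t1 = 296151%:R / 10 ^+ 6.
Hypothesis t2E : t2 = 805018%:R / 10 ^+ 6.
Let D : R := t2 * t1 ^+ 2 / 2 + t2 ^+ 3 / 6.

Let t1_gt0 : 0 < t1. Proof. rewrite t1E; lra. Qed.
Let t2_gt0 : 0 < t2. Proof. rewrite t2E; lra. Qed.
Let D_ge0 : 0 <= D.
Proof. by rewrite addr_ge0 ?divr_ge0 ?mulr_ge0 ?exprn_ge0 // ltW. Qed.
Let t1s_ge0 : 0 <= t1 ^+ 2. Proof. by rewrite exprn_ge0 // ltW. Qed.

(** Bounds the limiting integral from below by [v] without forming the limit. *)
Let lower_bound (v : R) (w1 w2 : R -> R) := exists2 C, 0 <= C &
  forall N T1 T2 : nat, (0 < N)%N -> (T1 <= T2 <= N)%N ->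
    T1%:R / N%:R = t1 -> T2%:R / N%:R = t2 ->
    v - C / N%:R <= grid_bound R t1 t2 N T1 T2 w1 w2.

Let ln_t : 2 - t1 / t2 * (271829%:R / 10 ^+ 5) <= ln t2 - ln t1.
Proof. exact: ln_ratio_ge. Qed.

Lemma lower_bound_le v v' w1 w2 : v <= v' -> lower_bound v' w1 w2 -> lower_bound v w1 w2.
Proof.
move=> vv' [C C0 H]; exists C => // N T1 T2 N0 T12 e1 e2.
by apply: le_trans (H N T1 T2 N0 T12 e1 e2); rewrite lerD2r.
Qed.

(** The weights are 1 and 1/x^2; the logarithm coming from [density1] is handled by [ln_t]. *)
Lemma lower_bound1 : lower_bound (1 / 2 / c) (weight1 R 1) (weight2 R 1).
Proof.
apply: lower_bound_le; last first.
  apply: (grid_bound_ge t1 t2 _ _ (fun x => 1 / 2 * x + t1 ^+ 2 / 2 * x^-1)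
     (fun x => D * (x ^+ 2)^-1 + 1 / 3 * x)
     (fun x => 1 / 2 * (x ^+ 2 / 2) + t1 ^+ 2 / 2 * ln x)
     (fun x => D * - x^-1 + 1 / 3 * (x ^+ 2 / 2)) t1_gt0).
  - move=> x x0; rewrite /weight1 /density1; field; rewrite gt_eqF //.
  - move=> x x0; rewrite /weight2 /density2 -/D; field; rewrite gt_eqF //.
  - apply: primitive_leD; apply: primitive_leZ => //.
      exact: primitive_le_id.
      by rewrite divr_ge0.
    exact: primitive_le_ln.
  - apply: primitive_leD; apply: primitive_leZ => //.
      exact: primitive_le_inv2.
    exact: primitive_le_id.
have t1s : 0 <= t1 ^+ 2 / 2 by rewrite divr_ge0.
have := ler_wpM2l t1s ln_t; move: (ln t1) (ln t2) => a b.
rewrite /D cE t1E t2E; lra.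
Qed.

(** The weights are 2 - x and 2/x^2. *)
Lemma lower_bound2 : lower_bound (2 / 3 / c) (weight1 R 2) (weight2 R 2).
Proof.
apply: lower_bound_le; last first.
  apply: (grid_bound_ge t1 t2 _ _
     (fun x => x + (t1 ^+ 2 * x^-1 + (1 / 2 * - x ^+ 2 + - (t1 ^+ 2 / 2))))
     (fun x => 2 * (D * (x ^+ 2)^-1 + 1 / 3 * x))
     (fun x => x ^+ 2 / 2 + (t1 ^+ 2 * ln x +
        (1 / 2 * - (x ^+ 3 / 3) + - (t1 ^+ 2 / 2) * x)))
     (fun x => 2 * (D * - x^-1 + 1 / 3 * (x ^+ 2 / 2))) t1_gt0).
  - move=> x x0; rewrite /weight1 /density1; field; rewrite gt_eqF //.
  - move=> x x0; rewrite /weight2 /density2 -/D; field; rewrite gt_eqF //.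
  - apply: primitive_leD; first exact: primitive_le_id.
    apply: primitive_leD; first by apply: primitive_leZ => //; exact: primitive_le_ln.
    apply: primitive_leD; last exact: primitive_le_cst.
    by apply: primitive_leZ => //; exact: primitive_le_sqr.
  - apply: primitive_leZ => //; apply: primitive_leD; apply: primitive_leZ => //.
      exact: primitive_le_inv2.
    exact: primitive_le_id.
have := ler_wpM2l t1s_ge0 ln_t; move: (ln t1) (ln t2) => a b.
rewrite /D cE t1E t2E; lra.
Qed.

(** The weights are the limits for infinite k; no logarithm occurs. *)
Lemma lower_bound_infty : lower_bound (1 / c) (fun x => x^-1) (fun x => 2 / x ^+ 3).
Proof.
apply: lower_bound_le; last first.
  apply: (grid_bound_ge t1 t2 _ _
     (fun x => 1 / 2 + t1 ^+ 2 / 2 * (x ^+ 2)^-1)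
     (fun x => 2 * D * (x ^+ 3)^-1 + 2 / 3)
     (fun x => 1 / 2 * x + t1 ^+ 2 / 2 * - x^-1)
     (fun x => 2 * D * - (2 * x ^+ 2)^-1 + 2 / 3 * x) t1_gt0).
  - move=> x x0; rewrite /density1; field; rewrite gt_eqF //.
  - move=> x x0; rewrite /density2 -/D; field; rewrite gt_eqF //.
  - apply: primitive_leD; first exact: primitive_le_cst.
    by apply: primitive_leZ; [rewrite divr_ge0|exact: primitive_le_inv2].
  - apply: primitive_leD; last exact: primitive_le_cst.
    by apply: primitive_leZ; [rewrite mulr_ge0|exact: primitive_le_inv3].
rewrite /D cE t1E t2E; lra.
Qed.

(* For k >= 2 the weights dominate the convex combination of the weights for
   k = 2 and for k infinite with coefficients 3/(k+1) and 1 - 3/(k+1), and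
   k/(k+1) is the same combination of 2/3 and 1. *)
Lemma lower_bound_all : exists2 C, 0 <= C & forall N T1 T2 k : nat, (0 < N)%N ->
  (T1 <= T2 <= N)%N -> T1%:R / N%:R = t1 -> T2%:R / N%:R = t2 ->
  k.+1%:R / k.+2%:R / c - C / N%:R <= \sum_(i < k.+1) win_lb R N T1 T2 i.
Proof.
have [C0 C00 H0] := sum_win_lb_ge R t1 t2 t1_gt0.
have [C1 C10 H1] := lower_bound1; have [C2 C20 H2] := lower_bound2.
have [C3 C30 H3] := lower_bound_infty.
exists (C0 + (C1 + C2 + C3)); first by rewrite !addr_ge0.
move=> N T1 T2 k N0 T12N e1 e2; have NR0 : 0 < N%:R :> R by rewrite ltr0n.
apply: le_trans (H0 N T1 T2 k.+1 N0 T12N e1 e2).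
rewrite mulrDl opprD [- (C0 / _) + _]addrC addrA lerD2r.
have /andP[T12 T2N] := T12N.
have NV : 0 <= N%:R^-1 :> R by rewrite invr_ge0 ltW.
(* The number of best buyers is [k.+1]; a single one is treated apart, as the interpolation starts
   at two. *)
case: k => [|k].
  apply: le_trans (H1 N T1 T2 N0 T12N e1 e2); rewrite lerD2l lerN2.
  by rewrite ler_pM2r ?invr_gt0 //; lra.
pose l : R := 3 / k.+3%:R.
have k3 : 3 <= k.+3%:R :> R by rewrite ler_nat.
have l01 : 0 <= l <= 1.
  by rewrite divr_ge0 //= ler_pdivrMr ?mul1r // ltr0n.
have -> : k.+2%:R / k.+3%:R = (1 - l) + l * (2 / 3) :> R.
  have -> : k.+2%:R = k.+3%:R - 1 :> R by rewrite -[k.+3%:R]natr1 addrK.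
  by rewrite /l; field; rewrite gt_eqF // ltr0n.
apply: le_trans (_ : (1 - l) * grid_bound R t1 t2 N T1 T2 (fun x => x^-1)
    (fun x => 2 / x ^+ 3)
  + l * grid_bound R t1 t2 N T1 T2 (weight1 R 2) (weight2 R 2) <= _).
  have := H2 N T1 T2 N0 T12N e1 e2; have := H3 N T1 T2 N0 T12N e1 e2.
  move: (grid_bound _ _ _ _ _ _ _ _) (grid_bound _ _ _ _ _ _ _ _) => g3 g2 h3 h2.
  have /andP[l0 l1] := l01; have l1' : 0 <= 1 - l by rewrite subr_ge0.
  have := ler_wpM2l l1' h3; have := ler_wpM2l l0 h2.
  have := mulr_ge0 l0 (mulr_ge0 C30 NV); have := mulr_ge0 l1' (mulr_ge0 C20 NV).
  have := mulr_ge0 C10 NV.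
  move: (c^-1) (N%:R^-1) => v w; lra.
have cell_ge T q : (T <= q < N)%N -> T%:R / N%:R <= cell_time R N q <= 1.
  by move=> /andP[Tq qN]; rewrite cell_time_le1 // cell_time_ge // Tq.
rewrite /grid_bound !mulrDr addrACA -!riemann_comb.
apply: lerD; apply: ler_riemannW => // q /andP[Tq qT]; set x := cell_time R N q.
  have /andP[x0 x1] : t1 <= x <= 1 by rewrite -e1 cell_ge // Tq (leq_trans qT).
  have x_gt0 : 0 < x := lt_le_trans t1_gt0 x0.
  (* The interpolation lemmas apply because t1 > 1/4 here and t2 > 4/5 in the second range. *)
  have y01 : 0 <= 1 - x <= 3 / 4 by move: x0; rewrite t1E; lra.
  rewrite ![_ * (_ * density1 _ _ _)]mulrA -mulrDl ler_wpM2r //.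
    by rewrite !divr_ge0 ?addr_ge0 ?exprn_ge0 // ltW.
  rewrite /weight1 mulrA -mulrDl ler_pM2r ?invr_gt0 //.
  by have := expr_interp R k (1 - x) y01; rewrite -/l; lra.
have /andP[x0 x1] : t2 <= x <= 1 by rewrite -e2 cell_ge // Tq.
have x_gt0 : 0 < x := lt_le_trans t2_gt0 x0.
have y01 : 0 <= 1 - x <= 1 / 5 by move: x0; rewrite t2E; lra.
rewrite ![_ * (_ * density2 _ _ _ _)]mulrA -mulrDl ler_wpM2r //.
  by rewrite addr_ge0 // divr_ge0 ?exprn_ge0 // ltW.
move: x x0 x1 x_gt0 y01 => x _ _ x_gt0 y01.
rewrite /weight2 ![_ * (_ / x ^+ 3)]mulrA -mulrDl ler_pM2r ?invr_gt0 ?exprn_gt0 //.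
have := expr2_interp R k (1 - x) y01; rewrite -/l -[k.+2.-1]/k.+1 -[2.-1]/1%N.
have -> : 1 - (1 - x) = x by ring.
have -> : l * (2 - 2 * (1 - x) ^+ 2 - 2 * x * (1 - x) ^+ 1) = 2 * l - l * (2 * (1 - x)).
  by ring.
lra.
Qed.

End Limits.

(** * The offline optimum *)

Lemma abel_sum (R : comPzRingType) (x a : nat -> R) n : x n = 0 ->
  \sum_(i < n) x i * a i = \sum_(k < n) (x k - x k.+1) * \sum_(i < k.+1) a i.
Proof.
suff H m : \sum_(i < m) x i * a i
    = \sum_(k < m) (x k - x k.+1) * \sum_(i < k.+1) a i + x m * \sum_(i < m) a i.
  by move=> xn; rewrite H xn mul0r addr0.
elim: m => [|m IH]; first by rewrite !big_ord0 mulr0 addr0.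
rewrite !big_ord_recr /= IH; ring.
Qed.

(** Extending the prices by 0 removes the boundary term of the Abel summation. *)
Definition ext (R : pzRingType) n (X : 'I_n -> R) (k : nat) : R :=
  if insub k is Some i then X i else 0.

Lemma ext_ord (R : pzRingType) n (X : 'I_n -> R) (i : 'I_n) : ext R n X i = X i.
Proof. by rewrite /ext valK. Qed.

Lemma ext_ge (R : pzRingType) n (X : 'I_n -> R) k : (n <= k)%N -> ext R n X k = 0.
Proof. by move=> nk; rewrite /ext insubN // -leqNgt. Qed.

Section Offline.
Variables (R : realType) (n : nat) (X : 'I_n -> R).
Hypothesis X_decreasing : forall i j : 'I_n, (i < j)%N -> X j < X i.
Hypothesis X_ge0 : forall i : 'I_n, 0 <= X i.

Let x := ext R n X.

Lemma ext_drop_ge0 k : 0 <= x k - x k.+1.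
Proof.
rewrite subr_ge0 /x; case: (ltnP k.+1 n) => kn.
  have kn' := ltnW kn.
  rewrite (ext_ord _ _ X (Ordinal kn)) (ext_ord _ _ X (Ordinal kn')).
  exact/ltW/X_decreasing.
rewrite (ext_ge _ _ _ _ kn) /ext; by case: insub.
Qed.

Lemma ext_telescope k : (k <= n)%N -> \sum_(k <= j < n) (x j - x j.+1) = x k.
Proof.
move=> kn; transitivity (- (x n - x k)); last first.
  by rewrite opprB /x (ext_ge _ _ _ _ (leqnn n)) subr0.
by rewrite -telescope_sumr // -sumrN; apply: eq_bigr => j _; rewrite opprB.
Qed.

Definition top_after (k : nat) (s : 'S_n.+1) : bool :=
  [exists i : 'I_n, (i <= k)%N && after_seller s i].

(** If buyer [i] arrives after the seller, [top_after k s] holds for all [k >= i], and the price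
    drops from [i] on add up to his price. *)
Lemma offline_welfare_le (s : 'S_n.+1) :
  offline_welfare X s <= \sum_(k < n) (x k - x k.+1) * (top_after k s)%:R.
Proof.
apply: bigmax_le => [|i si].
  by apply: sumr_ge0 => k _; rewrite mulr_ge0 // ext_drop_ge0.
rewrite -ext_ord -/x -(ext_telescope i (ltnW (ltn_ord i))).
rewrite -(big_mkord xpredT (fun k => (x k - x k.+1) * (top_after k s)%:R)).
rewrite [leRHS](big_cat_nat (leq0n i) (ltnW (ltn_ord i))) /= -[leLHS]add0r.
apply: lerD; first by apply: sumr_ge0 => k _; rewrite mulr_ge0 // ext_drop_ge0.
rewrite big_nat_cond [leRHS]big_nat_cond; apply: ler_sum => k /andP[/andP[ik _] _].
suff -> : top_after k s by rewrite mulr1.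
by apply/existsP; exists i; rewrite ik.
Qed.

Definition last_among (k : nat) (s : 'S_n.+1) (a : 'I_n.+1) : bool :=
  [forall b : 'I_n.+1, (b <= k)%N ==> (s b <= s a)%N].

(* Each of the agents 0, ..., k is the last one to arrive among them equally often. *)
Lemma last_among_sym k (a : 'I_n.+1) : (a <= k)%N ->
  (\sum_(s : 'S_n.+1) last_among k s a = \sum_(s : 'S_n.+1) last_among k s ord0)%N.
Proof.
move=> ak; rewrite (reindex_inj (mulgI (tperm ord0 a))) /=.
have tk (b : 'I_n.+1) : (b <= k)%N -> (tperm ord0 a b <= k)%N.
  by case: tpermP => // ->.
apply: eq_bigr => s _; congr nat_of_bool; apply/forallP/forallP => H b; apply/implyP => bk.
  have := implyP (H (tperm ord0 a b)) (tk _ bk).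
  by rewrite !permM tpermK tpermR.
by have := implyP (H (tperm ord0 a b)) (tk _ bk); rewrite !permM tpermR.
Qed.

(** In every order one of the agents 0, ..., k is the last among them, and by symmetry each is so
    equally often. *)
Lemma last_among_count k : (k <= n)%N ->
  ((n.+1)`! <= k.+1 * \sum_(s : 'S_n.+1) last_among k s ord0)%N.
Proof.
move=> kn; have -> : (k.+1 * \sum_(s : 'S_n.+1) last_among k s ord0)%N
   = (\sum_(a < n.+1 | (a < k.+1)%N) \sum_(s : 'S_n.+1) last_among k s a)%N.
  set c := (\sum_s _)%N.
  transitivity (\sum_(a < n.+1 | (a < k.+1)%N) c)%N.
    by rewrite -(big_ord_widen n.+1 (fun=> c)) // sum_nat_const card_ord.
  by apply: eq_bigr => a ak; rewrite last_among_sym.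
have -> : (n.+1)`! = (\sum_(s : 'S_n.+1) 1)%N by rewrite sum1_card card_Sn.
rewrite exchange_big; apply: leq_sum => s _ /=.
have [a ak amax] := @arg_maxnP _ ord0 (fun a : 'I_n.+1 => (a < k.+1)%N)
  (fun a => nat_of_ord (s a)) isT.
rewrite (bigD1 a) //= addn_gt0 lt0b; apply/orP; left.
by apply/forallP => b; apply/implyP => bk; exact: amax.
Qed.

(** If one of the [k.+1] best buyers follows the seller, the seller, agent 0, is not the last of the
    agents 0, ..., k+1. *)
Lemma top_after_count k : (k < n)%N ->
  \sum_(s : 'S_n.+1) (top_after k s)%:R <= k.+1%:R / k.+2%:R * (n.+1)`!%:R :> R.
Proof.
move=> kn; have := last_among_count _ kn.
rewrite -(ler_nat R) natrM natr_sum => cnt.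
have top_le s : (top_after k s)%:R <= 1 - (last_among k.+1 s ord0)%:R :> R.
  case: (boolP (top_after k s)) => [/existsP[i /andP[ik]]|_]; last first.
    by rewrite subr_ge0 lern1 leq_b1.
  rewrite /after_seller /seller => si.
  suff /negbTE -> : ~~ last_among k.+1 s ord0 by rewrite subr0.
  apply/negP => /forallP/(_ (buyer i))/implyP H.
  by move: si; rewrite ltnNge H // lift0 ltnS.
apply: (le_trans (ler_sum _ (fun s _ => top_le s))).
rewrite sumrB sumr_const card_Sn.
move: (\sum_s _) cnt => L cnt.
have k2 : 0 < k.+2%:R :> R by rewrite ltr0n.
have -> : k.+1%:R = k.+2%:R - 1 :> R by rewrite -[k.+2%:R]natr1 addrK.
rewrite mulrBl divff ?gt_eqF // mul1r mulrBl mul1r lerD2l lerN2.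
by rewrite mulrC ler_pdivrMr // mulrC.
Qed.

Lemma OPT_le : OPT X <= \sum_(k < n) (x k - x k.+1) * (k.+1%:R / k.+2%:R).
Proof.
rewrite ler_pdivrMr ?ltr0n ?fact_gt0 //.
apply: le_trans (ler_sum _ (fun s _ => offline_welfare_le s)) _.
rewrite exchange_big /= mulr_suml; apply: ler_sum => k _.
by rewrite -mulr_sumr -mulrA ler_wpM2l ?ext_drop_ge0 ?top_after_count.
Qed.

End Offline.

(** * The competitive ratio *)

Lemma ler_eps_nat (R : realType) (a b C : R) :
  (forall M : nat, (0 < M)%N -> b - C / M%:R <= a) -> b <= a.
Proof.
move=> H; rewrite leNgt; apply/negP => ab.
have e0 : 0 < b - a by rewrite subr_gt0.
pose M := (Num.bound `|C / (b - a)|).+1.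
have MR0 : 0 < M%:R :> R by rewrite ltr0n.
have CM : C / (b - a) < M%:R.
  apply: le_lt_trans (ler_norm _) _; apply: lt_trans (archi_boundP (normr_ge0 _)) _.
  by rewrite ltr_nat.
have := H M isT; rewrite lerBlDl -lerBlDr; apply/negP; rewrite -ltNge.
by rewrite ltr_pdivrMr // mulrC -ltr_pdivrMr.
Qed.

(* Replaces a large numeral by a variable, to keep the numeral from being
   unfolded in unary. *)
Lemma opaque_natr (R : pzSemiRingType) (m : nat) : exists a : nat, a%:R = m%:R :> R.
Proof. by exists m. Qed.

Lemma natr_mul2r_div (R : numFieldType) (a K M : nat) : (0 < M)%N ->
  (a * M)%:R / (K * M)%:R = a%:R / K%:R :> R.
Proof. by move=> M_gt0; rewrite !natrM -mulf_div divff ?mulr1 // pnatr_eq0 -lt0n. Qed.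

Lemma double_threshold_ratio (R : realType) (t1 t2 c : R)
  (t1E : t1 = 296151%:R / 10 ^+ 6) (t2E : t2 = 805018%:R / 10 ^+ 6)
  (cE : c = 1836835%:R / 10 ^+ 6)
  (d : measure_display) (T : measurableType d) (P : probability T R)
  (n : nat) (n_gt0 : (0 < n)%N)
  (U : 'I_n.+1 -> {RV P >-> R})
  (U_uniform : forall k : 'I_n.+1, uniform01 (U k))
  (U_independent : mutually_independent U)
  (X : 'I_n -> R)
  (X_decreasing : forall i j : 'I_n, (i < j)%N -> X j < X i)
  (X_ge0 : forall i : 'I_n, 0 <= X i)
  (X1_gt0 : 0 < X (Ordinal n_gt0)) :
  0 < ALG t1 t2 X U /\ OPT X / ALG t1 t2 X U <= c.
Proof.
have [a1 a1E] := opaque_natr R 296151%N.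
have [a2 a2E] := opaque_natr R 805018%N.
have [K KE'] := opaque_natr R 1000000%N.
have {KE'} KE : K%:R = 10 ^+ 6 :> R by rewrite KE'; lra.
have t1aE : t1 = a1%:R / K%:R := etrans t1E (esym (congr2 (fun a b => a / b) a1E KE)).
have t2aE : t2 = a2%:R / K%:R := etrans t2E (esym (congr2 (fun a b => a / b) a2E KE)).
have c_gt0 : 0 < c by rewrite cE; lra.
have a1_gt0 : (0 < a1)%N by rewrite -(ltr0n R) a1E; lra.
have a12 : (a1 <= a2)%N by rewrite -(ler_nat R) a1E a2E; lra.
have a2K : (a2 < K)%N by rewrite -(ltr_nat R) a2E KE; lra.
have K_gt0 : (0 < K)%N := leq_ltn_trans (leq0n _) a2K.
have [C C_ge0 win_ge] := lower_bound_all R c t1 t2 cE t1E t2E.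
(* The numerals in these equations make [done] very slow. *)
clear t1E t2E cE a1E a2E KE.
pose x := ext R n X; have x0E : x 0%N = X (Ordinal n_gt0).
  exact: (ext_ord R n X (Ordinal n_gt0)).
have drop_ge0 := ext_drop_ge0 R n X X_decreasing X_ge0.
pose V := \sum_(k < n) (x k - x k.+1) * (k.+1%:R / k.+2%:R).
have sum_drop : \sum_(k < n) (x k - x k.+1) = x 0%N.
  rewrite -(big_mkord xpredT (fun k => x k - x k.+1)).
  exact: ext_telescope.
have V_gt0 : 0 < V.
  (* Every coefficient (k+1)/(k+2) is at least 1/2, and the price drops add up to the top price. *)
  apply: lt_le_trans (_ : 2^-1 * x 0%N <= _); first by rewrite x0E mulr_gt0 ?invr_gt0.
  rewrite -sum_drop mulr_sumr; apply: ler_sum => k _; rewrite mulrC ler_wpM2l ?drop_ge0 //.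
  rewrite ler_pdivlMr ?ltr0n // mulrC ler_pdivrMr // -natrM ler_nat; lia.
have ALG_ge : V / c <= ALG t1 t2 X U.
  apply: (@ler_eps_nat _ _ _ (C * x 0%N)) => M M_gt0.
  (* With K = 10^6, both thresholds are end points of cells for every [M]. *)
  pose N := (K * M)%N; pose T1 := (a1 * M)%N; pose T2 := (a2 * M)%N.
  have N_gt0 : (0 < N)%N by rewrite muln_gt0 K_gt0.
  have e1 : T1%:R / N%:R = t1.
    exact: etrans (natr_mul2r_div _ _ _ _ M_gt0) (esym t1aE).
  have e2 : T2%:R / N%:R = t2.
    exact: etrans (natr_mul2r_div _ _ _ _ M_gt0) (esym t2aE).
  have T12 : (T1 <= T2)%N by rewrite leq_mul2r a12 orbT.
  have T1_gt0 : (0 < T1)%N by rewrite muln_gt0 a1_gt0.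
  have T2N : (T2 < N)%N by rewrite ltn_mul2r M_gt0.
  have ALG_lb : \sum_(k < n) (x k - x k.+1) * (k.+1%:R / k.+2%:R / c - C / N%:R)
      <= ALG t1 t2 X U.
    rewrite -e1 -e2 (ALG_grid R n X N N_gt0 d T P U U_uniform U_independent) //; last 2 first.
    - by rewrite T1_gt0 (leq_ltn_trans T12).
    - by rewrite (leq_trans T1_gt0).
    apply: le_trans (avg_welfare_ge R n X X_decreasing X_ge0 N T1 T2 N_gt0 T12).
    apply: le_trans (_ : \sum_(i < n) x i * win_lb R N T1 T2 i <= _); last first.
      apply: ler_sum => i _; rewrite /x ext_ord ler_wpM2l //.
      exact: win_lb_le (ltnW T2N) _ _ (ltn_ord i).
    rewrite abel_sum; last exact: ext_ge.
    apply: ler_sum => k _; rewrite ler_wpM2l ?drop_ge0 //.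
    have T12N : (T1 <= T2 <= N)%N by rewrite T12 ltnW.
    exact: (win_ge N T1 T2 k N_gt0 T12N e1 e2).
  apply: le_trans ALG_lb.
  under eq_bigr => k _ do rewrite mulrBr mulrA.
  rewrite sumrB -!mulr_suml -/V sum_drop lerD2l lerN2 mulrC mulrAC.
  rewrite ler_wpM2l //; first by rewrite mulr_ge0 ?x0E.
  (* As N = K M >= M, the error of order 1/N is absorbed by the one of order 1/M. *)
  rewrite lef_pV2 ?posrE ?ltr0n // ler_nat leq_pmull //.
have ALG_gt0 : 0 < ALG t1 t2 X U by apply: lt_le_trans ALG_ge; rewrite divr_gt0.
split=> //; rewrite ler_pdivrMr // mulrC -ler_pdivrMr //.
apply: le_trans ALG_ge; rewrite ler_pM2r ?invr_gt0 //.
exact: OPT_le.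
Qed.

Theorem theorem4p2 (R : realType)
  (d : measure_display) (T : measurableType d) (P : probability T R)
  (n : nat) (n_gt0 : (0 < n)%N)
  (U : 'I_n.+1 -> {RV P >-> R})
  (U_uniform : forall k : 'I_n.+1, uniform01 (U k))
  (U_independent : mutually_independent U)
  (X : 'I_n -> R)
  (X_decreasing : forall i j : 'I_n, (i < j)%N -> X j < X i)
  (X_ge0 : forall i : 'I_n, 0 <= X i)
  (X1_gt0 : 0 < X (Ordinal n_gt0)) :
  let t1 : R := 296151%:R / 10 ^+ 6 in
  let t2 : R := 805018%:R / 10 ^+ 6 in
  0 < ALG t1 t2 X U /\
  OPT X / ALG t1 t2 X U <= 1836835%:R / 10 ^+ 6.
Proof.
move=> t1 t2.
exact: (double_threshold_ratio R t1 t2 _ erefl erefl erefl d T P n n_gt0 U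
  U_uniform U_independent X X_decreasing X_ge0 X1_gt0).
Qed.
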